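(* Let $\alpha,\theta$ be nonconstant inner functions such that $\alpha$ divides $\theta$, and let $A_{\psi+\bar\chi}^{\theta,\alpha}\in \mathcal{T}(\theta,\alpha)$, where $\psi\in K^2_\alpha$ and $\chi\in K^2_\theta$. Then: (1) there is $\mu\in K^2_\alpha$ with $A_{\psi+\bar\chi}^{\theta,\alpha}-S^*_\alpha A_{\psi+\bar\chi}^{\theta,\alpha}S_\theta=\mu\otimes \tilde k^\theta_0$ if and only if there is $s\in\mathbb{C}$ such that $\psi=s\,k_0^\alpha$ and $P_{\frac{\theta}{\alpha}}\chi=-\bar s\,k_0^{\frac\theta\alpha}$; (2) there is $\nu\in K^2_\theta$ with $A_{\psi+\bar\chi}^{\theta,\alpha}-S^*_\alpha A_{\psi+\bar\chi}^{\theta,\alpha}S_\theta=\tilde k^\alpha_0\otimes \nu$ if and only if $P_\alpha\big(\chi\,\tfrac{\bar\theta}{\bar\alpha}\big)$ is a (complex) constant multiple of $k_0^\alpha$.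
   Context: $L^2=L^2(\mathbb T,m)$ with $\mathbb T$ the unit circle and $m$ normalized Lebesgue measure; $H^2\subset L^2$ is the Hardy space of the unit disc. For an inner function $u$, $K^2_u=H^2\ominus uH^2$, $P_u\colon L^2\to K^2_u$ is the orthogonal projection, $k_0^u=1-\overline{u(0)}\,u$, $\tilde k_0^u=\bar z(u-u(0))$ (both in $K_u^2$), and $S_u\colon K_u^2\to K_u^2$, $S_uf=P_u(zf)$. $\alpha$ divides $\theta$ means that $\theta/\alpha=\bar\alpha\theta$ is inner; $\bar\theta/\bar\alpha=\overline{\theta/\alpha}$. $(x\otimes y)f=\langle f,y\rangle x$. For $\varphi\in L^2$, $A_\varphi^{\theta,\alpha}f=P_\alpha(\varphi f)$ with domain $\{f\in K^2_\theta:\varphi f\in L^2\}$, which contains the dense subspace $K^2_\theta\cap H^\infty$; if it is bounded, $A_\varphi^{\theta,\alpha}$ also denotes its unique bounded extension $K^2_\theta\to K^2_\alpha$. $\mathcal T(\theta,\alpha)$ is the space of all bounded operators $K^2_\theta\to K^2_\alpha$ so obtained with $\varphi\in L^2$. *)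

(* Defs.v *)
From HB Require Import structures.
From mathcomp Require Import all_boot all_order all_algebra.
From mathcomp Require Import all_classical all_reals all_analysis.
From mathcomp Require Import complex.

Set Implicit Arguments.
Unset Strict Implicit.
Unset Printing Implicit Defensive.

Import Order.TTheory GRing.Theory Num.Theory.
Local Open Scope classical_set_scope.
Local Open Scope ring_scope.

(* Functions on the unit circle are represented as functions of t : R through
   t |-> exp(2 pi i t), where R carries the uniform probability measure on
   [0, 1]: the image of that measure is the normalized Lebesgue measure of the
   circle, and values outside [0, 1] are irrelevant.  Elements of L^2 are
   represented by functions, and equality in L^2 is
   [f = g %[ae circle_measure]]. *)

Section Circle.
Variable R : realType.

Definition circle_fun := R -> R[i].

Definition circle_measure : probability (measurableTypeR R) R :=
  uniform_prob (@ltr01 R).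

Definition zvar : circle_fun :=
  fun t => (cos (2 * pi * t) +i* sin (2 * pi * t))%C.

Definition conjf (f : circle_fun) : circle_fun := fun t => ((f t)^*)%C.

Definition cintegral (f : circle_fun) : R[i] :=
  ((\int[circle_measure]_t complex.Re (f t))%R
     +i* (\int[circle_measure]_t complex.Im (f t))%R)%C.

Definition L2 : set circle_fun :=
  [set f | (fun t => complex.Re (f t)) \in Lfun circle_measure 2%:E /\
           (fun t => complex.Im (f t)) \in Lfun circle_measure 2%:E].

Definition dot (f g : circle_fun) : R[i] := cintegral (f * conjf g).

Definition normL2 (f : circle_fun) : R := Num.sqrt (complex.Re (dot f f)).

(* The Hardy space, identified with the space of its boundary functions: the
   Fourier coefficients of index -1, -2, ... vanish. *)
Definition H2 : set circle_fun :=
  [set f | L2 f /\ forall n : nat, dot f (conjf (zvar ^+ n.+1)) = 0].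

(* The value at w, |w| < 1, of the analytic function with boundary values f in
   H^2, by Cauchy's formula f(w) = \int f(z) / (1 - \bar z w) dm(z). *)
Definition disc_ext (f : circle_fun) (w : R[i]) : R[i] :=
  cintegral (fun t => f t / (1 - (zvar t)^*%C * w)).

(* A function of H^2 with unimodular, hence bounded, boundary values lies in
   H^\infty. *)
Definition is_inner (u : circle_fun) : Prop :=
  H2 u /\ {ae circle_measure, forall t, `|u t| = 1}.

Definition nonconstant (u : circle_fun) : Prop :=
  ~ exists c : R[i], u = cst c %[ae circle_measure].

(* theta / alpha; on the circle 1 / alpha = \bar alpha as |alpha| = 1 a.e. *)
Definition inner_quot (theta alpha : circle_fun) : circle_fun :=
  conjf alpha * theta.

Definition divides (alpha theta : circle_fun) : Prop :=
  is_inner (inner_quot theta alpha).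

Definition model_space (u : circle_fun) : set circle_fun :=
  [set f | H2 f /\ forall h, H2 h -> dot f (u * h) = 0].

(* The orthogonal projection of f onto a subspace E (well defined almost
   everywhere when E is closed). *)
Definition oproj (E : set circle_fun) (f : circle_fun) : circle_fun :=
  xget 0 [set g | E g /\ forall h, E h -> dot (f - g) h = 0].

Definition model_proj (u : circle_fun) : circle_fun -> circle_fun :=
  oproj (model_space u).

Definition k0 (u : circle_fun) : circle_fun :=
  1 - cst (disc_ext u 0)^*%C * u.

Definition k0t (u : circle_fun) : circle_fun :=
  conjf zvar * (u - cst (disc_ext u 0)).

Definition bounded_operator (E F : set circle_fun)
    (A : circle_fun -> circle_fun) : Prop :=
  [/\ forall f, E f -> F (A f),
      forall (a : R[i]) f g, E f -> E g ->
        A (cst a * f + g) = cst a * A f + A g %[ae circle_measure]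
    & exists M : R, forall f, E f -> normL2 (A f) <= M * normL2 f].

Definition eq_op_on (E : set circle_fun) (A B : circle_fun -> circle_fun) :=
  forall f, E f -> A f = B f %[ae circle_measure].

(* The adjoint of a bounded operator A : E -> F between closed subspaces of
   L^2, to be applied to g in F. *)
Definition adjoint (E : set circle_fun) (A : circle_fun -> circle_fun)
    (g : circle_fun) : circle_fun :=
  xget 0 [set h | E h /\ forall f, E f -> dot (A f) g = dot f h].

Definition cshift (u f : circle_fun) : circle_fun := model_proj u (zvar * f).

Definition cshift_adj (u : circle_fun) : circle_fun -> circle_fun :=
  adjoint (model_space u) (cshift u).

Definition tensor (x y f : circle_fun) : circle_fun := cst (dot f y) * x.

(* A, as an operator K_theta -> K_alpha, belongs to T(theta, alpha) with symbol
   phi in L^2: it is the bounded extension of f |-> P_alpha (phi f), whose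
   domain [set f in K_theta | phi f in L^2] is dense. *)
Definition atto (theta alpha phi : circle_fun)
    (A : circle_fun -> circle_fun) : Prop :=
  [/\ L2 phi,
      bounded_operator (model_space theta) (model_space alpha) A
    & forall f, model_space theta f -> L2 (phi * f) ->
        A f = model_proj alpha (phi * f) %[ae circle_measure]].

End Circle.

(* Main.v *)
Require Import Defs.
From HB Require Import structures.
From mathcomp Require Import all_boot all_order all_algebra.
From mathcomp Require Import all_classical all_reals all_analysis.
From mathcomp Require Import measurable_realfun complex ring lra.

(** Put [beta = theta / alpha] and let [C_u f = u \bar z \bar f] be the natural
    conjugation of [K_u].  The compressed shift is
    [S_u f = z f - <f, k0t u> u], so when the defect of an operator with symbol
    [phi = psi + \bar chi] is tested against [h] in [K_alpha], all shift
    invariant terms cancel and a sum of two operators of rank one is left: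
      [<D f, h> = <f, k0t theta> <P, h> + <f, Q> <k0t alpha, h>],
    with [P = C_theta chi - e k0t alpha], [Q = \bar z \bar phi alpha] and a
    constant [e] ([defect_formula]).  The term of [P] that comes from [psi]
    vanishes because [psi theta] lies in [alpha H2].  As [k0t alpha] and
    [k0t theta] are nonzero for nonconstant inner functions, [D] has the form
    [mu (x) k0t theta] exactly when [Q] acts on [K_theta] as a multiple of
    [k0t theta] ([rank_one_theta]), and the form [k0t alpha (x) nu] exactly
    when [C_theta chi] acts on [K_alpha] as a multiple of [k0t alpha]
    ([rank_one_alpha]).

    The conjugations exchange [k0t u] and [k0 u].  Applying [C_alpha] to the
    test function, the second condition says that [chi \bar beta] acts on
    [K_alpha] as a multiple of [k0 alpha], which is (2) ([symbol_alpha]).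
    Applying [C_theta], the first one says that [beta psi + beta \bar chi - l]
    is orthogonal to [K_theta] for some constant [l] ([symbol_theta_conj]).
    Test functions from [beta K_alpha] then determine [psi], and test functions
    [beta (\bar g - \bar g(0))] with [g] in [K_beta] determine the projection
    of [chi] on [K_beta].  Conversely, the two conditions in (1) say that
    [chi + \bar s] is orthogonal to [K_beta], so that it equals [beta w] with
    [w] in [H2], and that [beta psi + beta \bar chi] differs from [\bar w] by a
    multiple of [theta]; on [K_theta] the function [\bar w] acts as the
    constant [\bar w(0)] ([symbol_theta]).

    An operator is given by its symbol on bounded functions only.  These are
    dense in [K_theta] ([bounded_model_dense]): the functions obtained from
    [k0 theta] by iterating the compressed shift are bounded, and orthogonality
    to all of them makes every Fourier coefficient vanish.

    Three facts about the circle carry the rest.  Orthogonal projections exist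
    because [L2] is complete ([approximation]).  A function whose Fourier
    coefficients vanish is zero ([null_coefs_ae0]): its product with any
    trigonometric polynomial again has vanishing coefficients, steep powers of
    such polynomials converge to indicators of arcs, so all integrals over arcs
    vanish and Lebesgue differentiation applies.  Finally the product of two
    functions of [H2] has no Fourier coefficients of negative index
    ([H2_mul_neg]), by density of the analytic polynomials. *)

Set Implicit Arguments.
Unset Strict Implicit.
Unset Printing Implicit Defensive.
Import Order.TTheory GRing.Theory Num.Theory.
Local Open Scope classical_set_scope.
Local Open Scope ring_scope.

(** * Integration of complex functions *)

Section Generic.
Context d (T : measurableType d) (R : realType) (mu : {measure set T -> \bar R}).

Lemma integrable_le (f g : T -> R) : measurable_fun setT f ->
  mu.-integrable setT (EFin \o g) -> {ae mu, forall t, 0 <= f t <= g t} ->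
  mu.-integrable setT (EFin \o f).
Proof.
move=> mf ig H; apply/integrableP; split; first exact/measurable_EFinP.
have/integrableP[mg] := ig; apply: le_lt_trans.
apply: ae_ge0_le_integral => //=.
- by apply/measurable_EFinP; exact: measurableT_comp.
- by apply/measurable_EFinP; apply: measurableT_comp => //; exact/measurable_EFinP.
apply: filterS H => t /andP[f0 fg] _.
by rewrite lee_fin ger0_norm // ger0_norm // (le_trans f0).
Qed.

(** Weakening is stated for an abstract measurable space because the Borel
    sets of the line occur below under two convertible structures. *)
Lemma aeS (P Q : T -> Prop) : (forall t, P t -> Q t) ->
  {ae mu, forall t, P t} -> {ae mu, forall t, Q t}.
Proof. by move=> PQ; apply: filterS. Qed.
Lemma aeS2 (P Q S : T -> Prop) : (forall t, P t -> Q t -> S t) ->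
  {ae mu, forall t, P t} -> {ae mu, forall t, Q t} -> {ae mu, forall t, S t}.
Proof. by move=> PQ; apply: filterS2. Qed.

Lemma eq_integral_ae (f g : T -> \bar R) : measurable_fun setT f ->
  measurable_fun setT g -> {ae mu, forall t, f t = g t} ->
  (\int[mu]_t f t = \int[mu]_t g t)%E.
Proof. by move=> mf mg fg; apply: ae_eq_integral => //; apply: aeS fg. Qed.

End Generic.

Section Basics.
Variable R : realType.
Notation mu := (circle_measure R).
Implicit Types f g h : circle_fun R.

Definition cmeasurable f :=
  measurable_fun setT (fun t => complex.Re (f t)) /\
  measurable_fun setT (fun t => complex.Im (f t)).

Definition L1 f :=
  mu.-integrable setT (EFin \o (fun t => complex.Re (f t))) /\
  mu.-integrable setT (EFin \o (fun t => complex.Im (f t))).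

(** The squared modulus as a real function: unlike the modulus it is a
    polynomial in the real and imaginary parts, and it is multiplicative. *)
Definition sqmod f : R -> R :=
  fun t => complex.Re (f t) ^+ 2 + complex.Im (f t) ^+ 2.

Definition ess_bounded f :=
  cmeasurable f /\ exists C : R, {ae mu, forall t, sqmod f t <= C}.

Lemma cReD (a b : R[i]) : complex.Re (a + b) = complex.Re a + complex.Re b.
Proof. by case: a b => [? ?] [? ?]. Qed.
Lemma cImD (a b : R[i]) : complex.Im (a + b) = complex.Im a + complex.Im b.
Proof. by case: a b => [? ?] [? ?]. Qed.
Lemma cReN (a : R[i]) : complex.Re (- a) = - complex.Re a.
Proof. by case: a. Qed.
Lemma cImN (a : R[i]) : complex.Im (- a) = - complex.Im a.
Proof. by case: a. Qed.
Lemma cReM (a b : R[i]) : complex.Re (a * b) =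
  complex.Re a * complex.Re b - complex.Im a * complex.Im b.
Proof. by case: a b => [? ?] [? ?]. Qed.
Lemma cImM (a b : R[i]) : complex.Im (a * b) =
  complex.Re a * complex.Im b + complex.Im a * complex.Re b.
Proof. by case: a b => [? ?] [? ?]. Qed.
Lemma cReJ (a : R[i]) : complex.Re (a^*)%C = complex.Re a.
Proof. by case: a. Qed.
Lemma cImJ (a : R[i]) : complex.Im (a^*)%C = - complex.Im a.
Proof. by case: a. Qed.
Definition ReImE := (cReD, cImD, cReN, cImN, cReM, cImM, cReJ, cImJ).

Lemma complexP (a b : R[i]) : complex.Re a = complex.Re b ->
  complex.Im a = complex.Im b -> a = b.
Proof. by case: a b => [? ?] [? ?] /= -> ->. Qed.

Lemma conjfK f : conjf (conjf f) = f.
Proof. by apply/funext => t; rewrite /conjf conjcK. Qed.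
Lemma conjfD f g : conjf (f + g) = conjf f + conjf g.
Proof. by apply/funext => t; rewrite /conjf !fctE rmorphD. Qed.
Lemma conjfN f : conjf (- f) = - conjf f.
Proof. by apply/funext => t; rewrite /conjf !fctE rmorphN. Qed.
Lemma conjfB f g : conjf (f - g) = conjf f - conjf g.
Proof. by rewrite conjfD conjfN. Qed.
Lemma conjfM f g : conjf (f * g) = conjf f * conjf g.
Proof. by apply/funext => t; rewrite /conjf !fctE rmorphM. Qed.
Lemma conjf1 : conjf (1 : circle_fun R) = 1.
Proof. by apply/funext => t; exact: conjc1. Qed.
Lemma conjf_cst (a : R[i]) : conjf (cst a : circle_fun R) = cst (a^*)%C.
Proof. by []. Qed.
Lemma conjfX f n : conjf (f ^+ n) = conjf f ^+ n.
Proof. by elim: n => [|n IH]; rewrite ?expr0 ?conjf1 // !exprS conjfM IH. Qed.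

Lemma cst1 : cst 1 = 1 :> circle_fun R. Proof. by []. Qed.
Lemma cst0 : cst 0 = 0 :> circle_fun R. Proof. by []. Qed.
Lemma cstN a : cst (- a) = - cst a :> circle_fun R. Proof. by []. Qed.
Lemma cstM a b : cst (a * b) = cst a * cst b :> circle_fun R. Proof. by []. Qed.
Lemma cstD a b : cst (a + b) = cst a + cst b :> circle_fun R. Proof. by []. Qed.

Lemma cmeasurable_cst (a : R[i]) : cmeasurable (cst a).
Proof. by split; exact: measurable_cst. Qed.
Lemma cmeasurable_conj f : cmeasurable f -> cmeasurable (conjf f).
Proof.
case=> mr mi; split; rewrite /conjf.
  by under eq_fun do rewrite cReJ.
by under eq_fun do rewrite cImJ; exact: measurableT_comp.
Qed.
Lemma cmeasurableD f g : cmeasurable f -> cmeasurable g -> cmeasurable (f + g).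
Proof.
move=> [fr fi] [gr gi]; split; under eq_fun do rewrite !fctE ReImE.
  exact: measurable_funD.
exact: measurable_funD.
Qed.
Lemma cmeasurableM f g : cmeasurable f -> cmeasurable g -> cmeasurable (f * g).
Proof.
move=> [fr fi] [gr gi]; split; under eq_fun do rewrite !fctE ReImE.
  by apply: measurable_funB; exact: measurable_funM.
by apply: measurable_funD; exact: measurable_funM.
Qed.
Lemma measurable_sqmod f : cmeasurable f -> measurable_fun setT (sqmod f).
Proof.
by move=> [fr fi]; apply: measurable_funD; apply: measurable_funX.
Qed.

Lemma sqmod_ge0 f t : 0 <= sqmod f t.
Proof. by rewrite addr_ge0 // sqr_ge0. Qed.
Lemma sqmodM f g t : sqmod (f * g) t = sqmod f t * sqmod g t.
Proof. rewrite /sqmod !fctE !ReImE; ring. Qed.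
Lemma sqmodJ f t : sqmod (conjf f) t = sqmod f t.
Proof. by rewrite /sqmod /conjf !ReImE sqrrN. Qed.
Lemma sqmodD_le f g t : sqmod (f + g) t <= 2 * (sqmod f t + sqmod g t).
Proof.
rewrite /sqmod !fctE !ReImE.
set a := complex.Re _; set b := complex.Re _; set c := complex.Im _; set d := complex.Im _.
have := sqr_ge0 (a - b); have := sqr_ge0 (c - d); nra.
Qed.

Lemma L1_le f (g : R -> R) : cmeasurable f -> mu.-integrable setT (EFin \o g) ->
  (forall t, `|complex.Re (f t)| <= g t /\ `|complex.Im (f t)| <= g t) -> L1 f.
Proof.
move=> [fr fi] ig H; split; apply: le_integrable ig => //=.
- exact/measurable_EFinP.
- by move=> t _; rewrite lee_fin; exact: le_trans (H t).1 (ler_norm _).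
- exact/measurable_EFinP.
- by move=> t _; rewrite lee_fin; exact: le_trans (H t).2 (ler_norm _).
Qed.

(** Membership in [L2] becomes a single integrability condition on the
    squared modulus. *)
Lemma L2P f : L2 f <-> cmeasurable f /\ mu.-integrable setT (EFin \o sqmod f).
Proof.
split=> [[Lr Li]|[[mr mi] Is]].
  split.
    by split; [move: Lr|move: Li]; rewrite !inE => /andP[/[!inE]/= ? _].
  have := integrableD measurableT (Lfun2_integrable_sqr Lr) (Lfun2_integrable_sqr Li).
  exact.
have key (g : R -> R) : measurable_fun setT g -> (forall t, g t ^+ 2 <= sqmod f t) ->
    g \in Lfun mu 2%:E.
  move=> mg gle; rewrite inE; apply/andP; split; rewrite inE //=.
  rewrite /finite_norm unlock poweR_lty //.
  have /integrableP[_] : mu.-integrable setT (EFin \o (fun t => g t ^+ 2)).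
    apply: integrable_le Is _; first exact: measurable_funX.
    by apply: aeW => t; rewrite sqr_ge0 gle.
  apply: le_lt_trans; rewrite le_eqVlt; apply/orP; left; apply/eqP.
  apply: eq_integral => t _ /=.
  by rewrite powR_mulrn // -normrX ger0_norm // sqr_ge0.
split; apply: key => // t; rewrite /sqmod; first by rewrite lerDl sqr_ge0.
by rewrite lerDr sqr_ge0.
Qed.

Lemma L2_cmeas f : L2 f -> cmeasurable f.
Proof. by case/L2P. Qed.
Lemma L2_int f : L2 f -> mu.-integrable setT (EFin \o sqmod f).
Proof. by case/L2P. Qed.
Lemma L2_conj f : L2 f -> L2 (conjf f).
Proof.
move=> /L2P[mf If]; apply/L2P; split; first exact: cmeasurable_conj.
by rewrite (_ : sqmod (conjf f) = sqmod f) //; apply/funext => t; rewrite sqmodJ.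
Qed.

Lemma L2D f g : L2 f -> L2 g -> L2 (f + g).
Proof.
move=> /L2P[mf If] /L2P[mg Ig]; have mfg := cmeasurableD mf mg.
apply/L2P; split => //.
apply: (@integrable_le _ (measurableTypeR R) R mu _ (fun t => 2 * (sqmod f t + sqmod g t))).
- exact: measurable_sqmod.
- exact: (integrableZl measurableT 2 (integrableD measurableT If Ig)).
- by apply: aeW => t; rewrite sqmod_ge0 sqmodD_le.
Qed.

Lemma L2_bdl f g : ess_bounded f -> L2 g -> L2 (f * g).
Proof.
move=> [mf [C HC]] /L2P[mg Ig]; apply/L2P; split; first exact: cmeasurableM.
apply: (@integrable_le _ (measurableTypeR R) R mu _ (fun t => C * sqmod g t)).
- by apply: measurable_sqmod; exact: cmeasurableM.
- exact: (integrableZl measurableT C Ig).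
- apply: aeS HC => t Ct.
  by rewrite sqmod_ge0 sqmodM ler_wpM2r // sqmod_ge0.
Qed.
Lemma L2_bdr f g : ess_bounded g -> L2 f -> L2 (f * g).
Proof. by rewrite mulrC; exact: L2_bdl. Qed.

Lemma bd_cst (a : R[i]) : ess_bounded (cst a).
Proof.
split; first exact: cmeasurable_cst.
by exists (sqmod (cst a) 0); apply: aeW.
Qed.
Lemma bd1 : ess_bounded 1. Proof. exact: bd_cst. Qed.
Lemma bd0 : ess_bounded 0. Proof. exact: bd_cst. Qed.
Lemma bdM f g : ess_bounded f -> ess_bounded g -> ess_bounded (f * g).
Proof.
move=> [mf [C HC]] [mg [D HD]]; split; first exact: cmeasurableM.
exists (C * D); apply: aeS2 HC HD => t Ct Dt.
by rewrite sqmodM ler_pM ?sqmod_ge0.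
Qed.
Lemma bdD f g : ess_bounded f -> ess_bounded g -> ess_bounded (f + g).
Proof.
move=> [mf [C HC]] [mg [D HD]]; split; first exact: cmeasurableD.
exists (2 * (C + D)); apply: aeS2 HC HD => t Ct Dt.
by rewrite (le_trans (sqmodD_le _ _ _)) // ler_wpM2l // lerD.
Qed.
Lemma bdN f : ess_bounded f -> ess_bounded (- f).
Proof. by move=> Hf; rewrite -mulN1r; apply: bdM => //; exact: (bd_cst (-1)). Qed.
Lemma bdJ f : ess_bounded f -> ess_bounded (conjf f).
Proof.
move=> [mf [C HC]]; split; first exact: cmeasurable_conj.
by exists C; apply: aeS HC => t; rewrite sqmodJ.
Qed.
Lemma bdX f n : ess_bounded f -> ess_bounded (f ^+ n).
Proof. by move=> bf; elim: n => [|n IH]; [exact: bd1|rewrite exprS; exact: bdM]. Qed.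

Lemma L2_cst (a : R[i]) : L2 (cst a : circle_fun R).
Proof.
apply/L2P; split; first exact: cmeasurable_cst.
exact: (finite_measure_integrable_cst mu (sqmod (cst a) 0) measurableT).
Qed.
Lemma L2_1 : L2 (1 : circle_fun R). Proof. exact: L2_cst. Qed.
Lemma L2_0 : L2 (0 : circle_fun R). Proof. exact: L2_cst. Qed.
Lemma L2_bd f : ess_bounded f -> L2 f.
Proof. by move=> bf; rewrite -(mulr1 f); apply: L2_bdl => //; exact: L2_1. Qed.
Lemma L2Z a f : L2 f -> L2 (cst a * f).
Proof. by apply: L2_bdl; exact: bd_cst. Qed.
Lemma L2N f : L2 f -> L2 (- f).
Proof. by move=> Hf; rewrite -mulN1r; exact: (L2Z (-1)). Qed.
Lemma L1_mul f g : L2 f -> L2 g -> L1 (f * g).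
Proof.
move=> /L2P[mf If] /L2P[mg Ig].
apply: (@L1_le _ (fun t => sqmod f t + sqmod g t)); first exact: cmeasurableM.
  exact: (integrableD measurableT If Ig).
move=> t; rewrite /sqmod !fctE !ReImE.
set a := complex.Re _; set b := complex.Re _; set c := complex.Im _; set d := complex.Im _.
have := sqr_ge0 (a - b); have := sqr_ge0 (c - d); have := sqr_ge0 (a + b).
have := sqr_ge0 (c + d); have := sqr_ge0 (a - d); have := sqr_ge0 (c + b).
have := sqr_ge0 (a + d); have := sqr_ge0 (c - b).
by split; rewrite ler_norml; apply/andP; split; nra.
Qed.
Lemma L2_L1 f : L2 f -> L1 f.
Proof. by move=> Hf; rewrite -(mulr1 f); apply: L1_mul => //; exact: L2_1. Qed.
Lemma cintegralD f g : L1 f -> L1 g ->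
  cintegral (f + g) = cintegral f + cintegral g.
Proof.
move=> [fr fi] [gr gi]; apply: complexP; rewrite ReImE /=.
  by rewrite -RintegralD //; apply: eq_Rintegral => t _; rewrite !fctE cReD.
by rewrite -RintegralD //; apply: eq_Rintegral => t _; rewrite !fctE cImD.
Qed.

Lemma cintegralZ a f : L1 f -> cintegral (cst a * f) = a * cintegral f.
Proof.
move=> [fr fi]; have iZ := integrableZl measurableT.
apply: complexP; rewrite ReImE /= -!RintegralZl //.
  rewrite -RintegralB //; [|exact: iZ fr|exact: iZ fi].
  by apply: eq_Rintegral => t _; rewrite !fctE cReM.
rewrite -RintegralD //; [|exact: iZ fi|exact: iZ fr].
by apply: eq_Rintegral => t _; rewrite !fctE cImM.
Qed.

Lemma cintegralJ f : L1 f -> cintegral (conjf f) = ((cintegral f)^*)%C.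
Proof.
move=> [fr fi]; apply: complexP; rewrite ReImE /=.
  by apply: eq_Rintegral => t _; rewrite /conjf cReJ.
rewrite -mulN1r -RintegralZl //.
by apply: eq_Rintegral => t _; rewrite /conjf cImJ mulN1r.
Qed.

Lemma cintegral_ae f g : L1 f -> L1 g -> f = g %[ae mu] ->
  cintegral f = cintegral g.
Proof.
move=> [fr fi] [gr gi] fg; apply: complexP => /=; congr fine;
  apply: ae_eq_integral => //; try exact: (measurable_int mu).
  by apply: aeS fg => t fgt _ /=; rewrite fgt.
by apply: aeS fg => t fgt _ /=; rewrite fgt.
Qed.

End Basics.

(** * The scalar product of L2 *)

Create HintDb l2 discriminated.
#[export] Hint Constants Opaque : l2.
Ltac bd := lazymatch goal with
  | |- ess_bounded (_ + _) => apply: bdD; bd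
  | |- ess_bounded (- _) => apply: bdN; bd
  | |- ess_bounded (conjf _) => apply: bdJ; bd
  | |- ess_bounded (_ * _) => apply: bdM; bd
  | |- ess_bounded (_ ^+ _) => apply: bdX; bd
  | |- ess_bounded (cst _) => exact: bd_cst
  | |- ess_bounded 1 => exact: bd1
  | |- ess_bounded 0 => exact: bd0
  | |- ess_bounded _ => solve [eauto 5 with l2]
  end.
Ltac l2 := lazymatch goal with
  | |- L2 (_ + _) => apply: L2D; l2
  | |- L2 (- _) => apply: L2N; l2
  | |- L2 (conjf _) => apply: L2_conj; l2
  | |- L2 (_ * _) => first [assumption | apply: L2_bdl; [bd|l2]
                            | apply: L2_bdr; [bd|l2]]
  | |- L2 (_ ^+ _) => apply: L2_bd; bd
  | |- L2 (cst _) => exact: L2_cst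
  | |- L2 1 => exact: L2_1
  | |- L2 0 => exact: L2_0
  | |- L2 _ => solve [eauto 5 with l2 | apply: L2_bd; bd]
  end.

Section Dot.
Variable R : realType.
Notation mu := (circle_measure R).
Implicit Types f g h : circle_fun R.

Lemma dotDl f g h : L2 f -> L2 g -> L2 h -> dot (f + g) h = dot f h + dot g h.
Proof.
by move=> *; rewrite /dot mulrDl cintegralD //; apply: L1_mul; l2.
Qed.
Lemma dotDr f g h : L2 f -> L2 g -> L2 h -> dot h (f + g) = dot h f + dot h g.
Proof.
by move=> *; rewrite /dot conjfD mulrDr cintegralD //; apply: L1_mul; l2.
Qed.
Lemma dotZl a f g : L2 f -> L2 g -> dot (cst a * f) g = a * dot f g.
Proof.
by move=> *; rewrite /dot -mulrA cintegralZ //; apply: L1_mul; l2.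
Qed.
Lemma dotZr a f g : L2 f -> L2 g -> dot f (cst a * g) = (a^*)%C * dot f g.
Proof.
move=> *; rewrite /dot conjfM conjf_cst mulrCA cintegralZ //; apply: L1_mul; l2.
Qed.
Lemma dotNl f g : L2 f -> L2 g -> dot (- f) g = - dot f g.
Proof. by move=> *; rewrite -mulN1r -cst1 -cstN dotZl // mulN1r. Qed.
Lemma dotNr f g : L2 f -> L2 g -> dot f (- g) = - dot f g.
Proof.
by move=> *; rewrite -[in LHS](mulN1r g) -cst1 -cstN dotZr // rmorphN1 mulN1r.
Qed.
Lemma dotBl f g h : L2 f -> L2 g -> L2 h -> dot (f - g) h = dot f h - dot g h.
Proof. by move=> *; rewrite dotDl ?dotNl //; l2. Qed.
Lemma dotBr f g h : L2 f -> L2 g -> L2 h -> dot h (f - g) = dot h f - dot h g.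
Proof. by move=> *; rewrite dotDr ?dotNr //; l2. Qed.
Lemma dotC f g : L2 f -> L2 g -> dot g f = ((dot f g)^*)%C.
Proof.
move=> Lf Lg; rewrite /dot -cintegralJ; first by rewrite conjfM conjfK mulrC.
by apply: L1_mul; l2.
Qed.
(** Adjointness of multiplication operators is an identity of integrands. *)
Lemma dot_move h f g : dot (h * f) g = dot f (conjf h * g).
Proof. by rewrite /dot conjfM conjfK; congr cintegral; ring. Qed.
Lemma dotJ f g : dot (conjf f) (conjf g) = dot g f.
Proof. by rewrite /dot conjfK mulrC. Qed.
Lemma dot0l f : L2 f -> dot 0 f = 0.
Proof.
move=> Lf; have -> : 0 = cst 0 * 1 :> circle_fun R by rewrite cst0 mul0r.
by rewrite dotZl ?mul0r //; l2.
Qed.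
Lemma dot_ael f f' g : L2 f -> L2 f' -> L2 g -> f = f' %[ae mu] ->
  dot f g = dot f' g.
Proof.
move=> Lf Lf' Lg ff'; apply: cintegral_ae; try by apply: L1_mul; l2.
by apply: aeS ff' => t + _ => /(_ I); rewrite !fctE => ->.
Qed.
Lemma dot_aer f g g' : L2 f -> L2 g -> L2 g' -> g = g' %[ae mu] ->
  dot f g = dot f g'.
Proof. by move=> Lf Lg Lg' gg'; rewrite dotC // (dot_ael _ _ _ gg') // -dotC. Qed.

Definition nsq f : R := complex.Re (dot f f).
Definition sqc (z : R[i]) : R := complex.Re z ^+ 2 + complex.Im z ^+ 2.

Lemma sqc_ge0 z : 0 <= sqc z. Proof. by rewrite addr_ge0 ?sqr_ge0. Qed.
Lemma sqc_eq0 z : (sqc z == 0) = (z == 0).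
Proof.
rewrite paddr_eq0 ?sqr_ge0 // !sqrf_eq0.
apply/andP/eqP => [[/eqP r0 /eqP i0]|-> //]; exact: complexP.
Qed.

Lemma nsqE f : nsq f = (\int[mu]_t sqmod f t)%R.
Proof.
apply: eq_Rintegral => t _; rewrite /conjf !fctE !ReImE /sqmod; ring.
Qed.
Lemma nsq_ge0 f : 0 <= nsq f.
Proof. by rewrite nsqE; apply: Rintegral_ge0 => t _; exact: sqmod_ge0. Qed.
Lemma dotff f : dot f f = (nsq f)%:C%C.
Proof.
apply: complexP => //=.
rewrite (_ : (fun _ => _) = (fun _ => 0)); last first.
  by apply/funext => t; rewrite /conjf !fctE !ReImE; ring.
by rewrite Rintegral_cst // mul0r.
Qed.
Lemma nsq_int f : L2 f -> (\int[mu]_t (sqmod f t)%:E)%E = (nsq f)%:E.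
Proof.
move=> Lf; rewrite nsqE fineK //.
by apply: integrable_fin_num => //; exact: L2_int.
Qed.

Lemma nsq0_ae f : L2 f -> nsq f = 0 -> f = 0 %[ae mu].
Proof.
move=> Lf f0; have [mf If] := (L2P f).1 Lf.
have mF : measurable_fun setT (EFin \o sqmod f).
  by apply/measurable_EFinP; exact: measurable_sqmod.
have [+ _] := @ae_eq_integral_abs _ (measurableTypeR R) R mu setT measurableT _ mF.
have -> : (\int[mu]_(x in setT) `|(EFin \o sqmod f) x| = 0)%E.
  rewrite -[RHS](congr1 EFin f0) -nsq_int //; apply: eq_integral => t _.
  by rewrite /= ger0_norm // sqmod_ge0.
move=> /(_ erefl); apply: aeS => t /(_ I) /= [] /eqP.
by rewrite -/(sqc (f t)) sqc_eq0 => /eqP.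
Qed.

Lemma nsqD f g : L2 f -> L2 g ->
  nsq (f + g) = nsq f + nsq g + 2 * complex.Re (dot f g).
Proof.
move=> Lf Lg; rewrite /nsq dotDl ?dotDr //; try l2.
rewrite (dotC Lf Lg) !ReImE; ring.
Qed.
Lemma nsqZ a f : L2 f -> nsq (cst a * f) = sqc a * nsq f.
Proof.
move=> Lf; rewrite /nsq dotZl ?dotZr //; try l2.
by rewrite dotff /sqc !ReImE /=; ring.
Qed.
Lemma nsqN f : L2 f -> nsq (- f) = nsq f.
Proof. by move=> Lf; rewrite /nsq dotNl ?dotNr ?opprK //; l2. Qed.
Lemma nsqB f g : L2 f -> L2 g ->
  nsq (f - g) = nsq f + nsq g - 2 * complex.Re (dot f g).
Proof. by move=> Lf Lg; rewrite nsqD ?nsqN ?dotNr ?cReN ?mulrN //; l2. Qed.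
Lemma parallelogram f g : L2 f -> L2 g ->
  nsq (f + g) + nsq (f - g) = 2 * nsq f + 2 * nsq g.
Proof. by move=> Lf Lg; rewrite nsqD ?nsqB //; ring. Qed.
Lemma nsqD_le f g : L2 f -> L2 g -> nsq (f + g) <= 2 * (nsq f + nsq g).
Proof.
move=> Lf Lg; have := parallelogram Lf Lg; have := nsq_ge0 (f - g); lra.
Qed.
Lemma nsq0 : nsq 0 = 0.
Proof. by rewrite /nsq dot0l //; l2. Qed.

(** Subtracting from [f] a real multiple [r] of [<f,g> g] gives a quadratic
    polynomial in [r]; its sign yields Cauchy-Schwarz, and near a minimising
    sequence it yields orthogonality. *)
Lemma nsq_sub_dot (r : R) f g : L2 f -> L2 g ->
  nsq (f - cst (r%:C%C * dot f g) * g) =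
  nsq f - 2 * r * sqc (dot f g) + r ^+ 2 * sqc (dot f g) * nsq g.
Proof.
move=> Lf Lg; rewrite nsqB ?nsqZ ?dotZr //; try l2.
rewrite /sqc; case: (dot f g) => x y /=; ring.
Qed.

(** The discriminant of the quadratic polynomial in [r]; the degenerate case
    [N = 0] is linear and forces [D = 0]. *)
Lemma quad_bound (a D N : R) : 0 <= a -> 0 <= D -> 0 <= N ->
  (forall r : R, 0 <= a - 2 * r * D + r ^+ 2 * D * N) -> D <= a * N.
Proof.
move=> a0 D0 N0 H; have [N00|Nn0] := eqVneq N 0.
  rewrite N00 mulr0 leNgt; apply/negP => Dp.
  have := H ((a + 1) / (2 * D)); rewrite N00 mulr0 addr0.
  have -> : 2 * ((a + 1) / (2 * D)) * D = a + 1 by field; lra.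
  lra.
have Np : 0 < N by rewrite lt_def Nn0.
have := H N^-1.
have -> : a - 2 * N^-1 * D + N^-1 ^+ 2 * D * N = (a * N - D) / N by field.
by rewrite pmulr_lge0 ?invr_gt0 // subr_ge0.
Qed.

Lemma cauchy_schwarz f g : L2 f -> L2 g -> sqc (dot f g) <= nsq f * nsq g.
Proof.
move=> Lf Lg; apply: quad_bound; rewrite ?nsq_ge0 ?sqc_ge0 // => r.
by rewrite -nsq_sub_dot // nsq_ge0.
Qed.

Lemma nsq_ae f g : L2 f -> L2 g -> f = g %[ae mu] -> nsq f = nsq g.
Proof.
by move=> Lf Lg fg; rewrite /nsq (dot_ael _ _ _ fg) // (dot_aer _ _ _ fg).
Qed.

Lemma normL2_sqr f : normL2 f ^+ 2 = nsq f.
Proof. by rewrite sqr_sqrtr // nsq_ge0. Qed.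

End Dot.

(** * Completeness and orthogonal approximation *)

Section RealCompleteness.
Import numFieldNormedType.Exports.
Context d (T : measurableType d) (R : realType) (mu : {measure set T -> \bar R}).

(** The steps are dominated by a geometric series of ratio one half. *)
Lemma geometric_steps_cvg (u : R^nat) (C : R) : 0 <= C ->
  (forall n, (u n.+1 - u n) ^+ 2 <= C * (4^-1) ^+ n) -> cvgn u.
Proof.
move=> C0 H; have := @is_cvg_geometric_series R (Num.sqrt C) 2^-1.
have h2 : `|2^-1 : R| < 1 by rewrite ger0_norm; lra.
move=> /(_ h2) gc.
have sc : cvgn (series (telescope u)).
  apply: normed_cvg; apply: series_le_cvg gc => n /=.
  - exact: normr_ge0.
  - by apply: geometric_ge0; rewrite ?sqrtr_ge0 //; lra.
  have h0 : 0 <= Num.sqrt C * 2^-1 ^+ n.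
    by rewrite mulr_ge0 ?sqrtr_ge0 ?exprn_ge0 //; lra.
  rewrite -[leRHS](ger0_norm h0) -ler_sqr ?nnegrE ?normr_ge0 // !real_normK ?num_real // exprMn sqr_sqrtr // -exprM.
  by rewrite mulnC exprM (_ : 2^-1 ^+ 2 = 4^-1 :> R) ?H //; field.
have -> : u = (fun n => u 0%N + series (telescope u) n).
  by apply/funext => n; rewrite -eq_sum_telescope.
by apply: is_cvgD => //; exact: is_cvg_cst.
Qed.

(** If the squared steps have integrals at most [8^-n], then the sum of
    [4^n] times these squared steps is integrable, hence finite almost
    everywhere; where it is finite the steps decay geometrically. *)
Lemma fast_cauchy_ae (u : nat -> T -> R) :
  (forall n, measurable_fun setT (u n)) ->
  (forall n, (\int[mu]_t ((u n.+1 t - u n t) ^+ 2)%:E <= ((8^-1) ^+ n)%:E)%E) ->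
  exists g : T -> R, measurable_fun setT g /\
    {ae mu, forall t, u ^~ t @ \oo --> g t}.
Proof.
move=> mu_ H.
pose q n t := 4 ^+ n * (u n.+1 t - u n t) ^+ 2.
have q0 n t : 0 <= q n t by rewrite mulr_ge0 ?sqr_ge0 // exprn_ge0.
have mq n : measurable_fun setT (EFin \o q n).
  apply/measurable_EFinP; apply: measurable_funM => //.
  by apply: measurable_funX; exact: measurable_funB.
pose K t := (\sum_(0 <= n <oo) (q n t)%:E)%E.
have K0 t : (0 <= K t)%E by apply: nneseries_ge0 => n _ _; rewrite lee_fin.
have mK : measurable_fun setT K.
  apply: ge0_emeasurable_sum => //; last by move=> k _; exact: mq.
  by move=> k x _ _; rewrite lee_fin.
have Kfin : mu.-integrable setT K.
  apply/integrableP; split => //.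
  under eq_integral do rewrite gee0_abs //.
  rewrite /K integral_nneseries //; last by move=> n t _; rewrite lee_fin.
  apply: (@le_lt_trans _ _ (2 : R)%:E); last exact: ltry.
  apply: lime_le; first by apply: is_cvg_nneseries => n _ _; apply: integral_ge0 => t _; rewrite lee_fin.
  apply: nearW => n.
  apply: (@le_trans _ _ (\sum_(0 <= i < n) (2^-1 ^+ i)%:E)%E).
    apply: lee_sum => i _.
    have -> : (2^-1 ^+ i)%:E = ((4 ^+ i)%:E * (8^-1 ^+ i)%:E :> \bar R)%E.
      by rewrite -EFinM -exprMn; congr (_ ^+ i)%:E; field.
    under eq_integral do rewrite /q EFinM.
    rewrite ge0_integralZl //.
    - by apply: lee_wpmul2l => //; rewrite lee_fin exprn_ge0.
    - apply/measurable_EFinP; apply: measurable_funX; exact: measurable_funB.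
    - by move=> t _; rewrite lee_fin sqr_ge0.
  rewrite sumEFin lee_fin.
  have := @geometric_le_lim R n 1 2^-1 ler01.
  rewrite ger0_norm; last by lra.
  have -> : 1 * (1 - 2^-1)^-1 = 2 :> R by field.
  rewrite /series /=; under eq_bigr do rewrite mul1r.
  by apply; lra.
pose E := [set t | K t \is a fin_num].
have mE : measurable E.
  by rewrite -[E]setTI; exact: emeasurable_fin_num.
have cvE t : E t -> cvgn (u ^~ t).
  move=> Et; apply: (@geometric_steps_cvg _ (fine (K t))).
    by rewrite fine_ge0.
  move=> n; have : ((q n t)%:E <= K t)%E.
    apply: (@le_trans _ _ (\sum_(0 <= i < n.+1) (q i t)%:E)%E); last first.
      by apply: nneseries_lim_ge => k _ _; rewrite lee_fin.
    by rewrite big_nat_recr //= leeDr // sume_ge0 // => i _; rewrite lee_fin.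
  rewrite -(fineK Et) lee_fin /q => h.
  rewrite exprVn ler_pdivlMr ?exprn_gt0 // mulrC //.
pose v n t := u n t * \1_E t.
have cv t : cvgn (v ^~ t).
  have [Et|nEt] := pselect (E t).
    rewrite (_ : v ^~ t = u ^~ t); first exact: cvE.
    by apply/funext => n; rewrite /v indicE mem_set // mulr1.
  rewrite (_ : v ^~ t = cst 0); first exact: is_cvg_cst.
  by apply/funext => n; rewrite /v indicE memNset // mulr0.
exists (fun t => limn (v ^~ t)); split.
  apply: (@measurable_fun_cvg _ _ _ setT v) => //.
  by move=> n; apply: measurable_funM => //; exact: measurable_indic.
have := integrable_ae measurableT Kfin; apply: filterS => t /(_ I) Et.
have -> : u ^~ t = v ^~ t; last exact: cv.
by apply/funext => n; rewrite /v indicE mem_set // mulr1.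
Qed.

End RealCompleteness.

Section Fatou.
Import numFieldNormedType.Exports.
Context d (T : measurableType d) (R : realType) (mu : {measure set T -> \bar R}).

(** The lower limit in Fatou's lemma is a limit almost everywhere, and is
    governed by the tail of the sequence. *)
Lemma fatou_bound (f_ : nat -> T -> R) (f : T -> R) (c : R) :
  (forall n, measurable_fun setT (f_ n)) -> measurable_fun setT f ->
  (forall n t, 0 <= f_ n t) ->
  {ae mu, forall t, f_ ^~ t @ \oo --> f t} ->
  (exists N, forall n, (N <= n)%N -> (\int[mu]_t (f_ n t)%:E <= c%:E)%E) ->
  (\int[mu]_t (f t)%:E <= c%:E)%E.
Proof.
move=> mf_ mf f0 cv [N HN].
have mEf_ n : measurable_fun setT (EFin \o f_ n) by exact/measurable_EFinP.
have mEf : measurable_fun setT (EFin \o f) by exact/measurable_EFinP.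
have := @fatou _ T R mu setT measurableT (fun n => EFin \o f_ n) mEf_
  (fun n t _ => f0 n t).
have -> : (\int[mu]_(x in setT) limn_einf (fun n => (EFin \o f_ n) x) =
           \int[mu]_t (f t)%:E)%E.
  apply: ae_eq_integral => //.
    apply: measurableT_comp => //.
    apply: (@measurable_fun_limn_esup _ T R setT
      (fun n => -%E \o (EFin \o f_ n))) => n.
    exact: measurableT_comp.
  apply: filterS cv => t ft _; apply: (cvg_limn_einf_sup _).1.
  by apply: cvg_EFin => //; exact: nearW.
move/le_trans; apply; rewrite limn_einf_lim; apply: lime_le.
  exact: is_cvg_einfs.
near=> n; apply: (@le_trans _ _ (\int[mu]_t (f_ n t)%:E)%E); last first.
  by apply: HN; near: n; exact: nbhs_infty_ge.
by apply: ereal_inf_lbound; exists n => //=.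
Unshelve. all: by end_near. Qed.

End Fatou.

Section Approximation.
Import numFieldNormedType.Exports.
Variable R : realType.
Notation mu := (circle_measure R).
Implicit Types f g h v w : circle_fun R.

Lemma expr_small (e c : R) : 0 < e -> exists n, c * 8^-1 ^+ n <= e.
Proof.
move=> e0; have h8 : `|8^-1 : R| < 1 by rewrite ger0_norm; lra.
have := @cvg_geometric R c _ h8.
move=> /cvgrPdist_le/(_ _ e0)[N _ HN]; exists N.
have := HN N (leqnn N); rewrite /= sub0r normrN; exact: le_trans (ler_norm _).
Qed.

Lemma pow8_gt0 n : 0 < 8^-1 ^+ n :> R.
Proof. by rewrite exprn_gt0 // invr_gt0 ltr0n. Qed.

Lemma small_le0 (x c : R) : (forall n, x <= c * 8^-1 ^+ n) -> x <= 0.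
Proof.
move=> H; rewrite leNgt; apply/negP => x0.
have [n Hn] := @expr_small (x / 2) c (divr_gt0 x0 (ltr0n _ 2)).
have := H n; lra.
Qed.

(** Weights for the triangle inequality chosen so that the bound for a tail
    reproduces itself: [2 * 3/8 + 2 <= 3]. *)
Lemma fast_cauchy_tail (s : nat -> circle_fun R) :
  (forall n, L2 (s n)) -> (forall n, nsq (s n.+1 - s n) <= 8^-1 ^+ n) ->
  forall k n, nsq (s (n + k)%N - s n) <= 3 * 8^-1 ^+ n.
Proof.
move=> Ls H; elim=> [|k IH] n.
  by rewrite addn0 subrr nsq0 mulr_ge0 // ltW // pow8_gt0.
have -> : s (n + k.+1)%N - s n = (s (n.+1 + k)%N - s n.+1) + (s n.+1 - s n).
  by rewrite addnS addSn; ring.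
apply: le_trans (nsqD_le _ _) _; try l2.
have := IH n.+1; have := H n; rewrite exprS.
have : 0 <= 8^-1 ^+ n :> R by rewrite ltW // pow8_gt0.
lra.
Qed.

(** The real and imaginary parts converge almost everywhere, and the lemma of
    Fatou applied to [s m - s n] as [m] grows bounds the distance to the
    limit. *)
Lemma L2_complete (s : nat -> circle_fun R) :
  (forall n, L2 (s n)) -> (forall n, nsq (s n.+1 - s n) <= 8^-1 ^+ n) ->
  exists2 g, L2 g & forall n, nsq (g - s n) <= 3 * 8^-1 ^+ n.
Proof.
move=> Ls H; have ms n := L2_cmeas (Ls n).
have key (p : R[i] -> R) : (forall a b, p (a - b) = p a - p b) ->
    (forall a : R[i], p a ^+ 2 <= sqc a) ->
    (forall n, measurable_fun setT (fun t => p (s n t))) ->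
    exists g : R -> R, measurable_fun setT g /\
      {ae mu, forall t, (fun n => p (s n t)) @ \oo --> g t}.
  move=> pB ple mp; apply: (@fast_cauchy_ae _ (measurableTypeR R) R mu) => //.
  move=> n; have Ld : L2 (s n.+1 - s n) by l2.
  have mq : measurable_fun setT (fun t => (p (s n.+1 t) - p (s n t)) ^+ 2).
    by apply: measurable_funX; exact: measurable_funB.
  apply: (@le_trans _ _ (\int[mu]_t (sqmod (s n.+1 - s n) t)%:E)%E); last first.
    by rewrite nsq_int // lee_fin H.
  apply: (@ge0_le_integral _ (measurableTypeR R) R mu setT measurableT) => //.
  - by move=> t _; rewrite lee_fin sqr_ge0.
  - exact/measurable_EFinP.
  - by apply/measurable_EFinP; apply: measurable_sqmod; apply: L2_cmeas; l2.
  - by move=> t _; rewrite lee_fin -pB ple.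
have ReB (a b : R[i]) : complex.Re (a - b) = complex.Re a - complex.Re b.
  by rewrite !ReImE.
have ImB (a b : R[i]) : complex.Im (a - b) = complex.Im a - complex.Im b.
  by rewrite !ReImE.
have Rele (a : R[i]) : complex.Re a ^+ 2 <= sqc a by rewrite lerDl sqr_ge0.
have Imle (a : R[i]) : complex.Im a ^+ 2 <= sqc a by rewrite lerDr sqr_ge0.
have [gr [mgr cgr]] := key (@complex.Re R) ReB Rele (fun n => (ms n).1).
have [gi [mgi cgi]] := key (@complex.Im R) ImB Imle (fun n => (ms n).2).
pose g : circle_fun R := fun t => (gr t +i* gi t)%C.
have mg : cmeasurable g by [].
have bound n : (\int[mu]_t (sqmod (g - s n) t)%:E <= (3 * 8^-1 ^+ n)%:E)%E.
  apply: (@fatou_bound _ (measurableTypeR R) R mu (fun m => sqmod (s m - s n))).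
  - by move=> m; apply: measurable_sqmod; apply: L2_cmeas; l2.
  - apply: measurable_sqmod; apply: cmeasurableD => //.
    by apply: L2_cmeas; l2.
  - by move=> m t; exact: sqmod_ge0.
  - apply: aeS2 cgr cgi => t cr ci.
    rewrite /sqmod !fctE !ReImE /=.
    under eq_fun do rewrite !fctE !ReImE.
    have sq (u : R^nat) (l : R) : u @ \oo --> l -> (fun m => u m ^+ 2) @ \oo --> l ^+ 2.
      by move=> ul; rewrite expr2; under eq_fun do rewrite expr2; exact: cvgM.
    by apply: cvgD; apply: sq; apply: cvgB => //; exact: cvg_cst.
  - exists n => m nm; have Ld : L2 (s m - s n) by l2.
    by rewrite nsq_int // lee_fin -(subnKC nm) fast_cauchy_tail.
have Ld n : L2 (g - s n).
  apply/L2P; have md : cmeasurable (g - s n).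
    by apply: cmeasurableD => //; apply: L2_cmeas; l2.
  split => //; apply/integrableP; split.
    by apply/measurable_EFinP; exact: measurable_sqmod.
  under eq_integral do rewrite /= ger0_norm ?sqmod_ge0 //.
  by apply: le_lt_trans (bound n) _; rewrite ltry.
exists g; first by rewrite -(subrK (s 0%N) g); apply: L2D.
by move=> n; rewrite -lee_fin -nsq_int.
Qed.

Definition subspace (V : set (circle_fun R)) :=
  [/\ V `<=` @L2 R, V 0 & forall a f g, V f -> V g -> V (f + cst a * g)].

Definition adherent (V : set (circle_fun R)) g :=
  forall e : R, 0 < e -> exists2 v, V v & nsq (g - v) <= e.

(** Orthogonality is a closed condition, by Cauchy-Schwarz. *)
Lemma adherent_orth V g h : V `<=` @L2 R -> L2 g -> L2 h -> adherent V g ->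
  (forall v, V v -> dot v h = 0) -> dot g h = 0.
Proof.
move=> VL Lg Lh ag H; apply/eqP; rewrite -sqc_eq0 eq_le sqc_ge0 andbT.
apply: (@small_le0 _ (nsq h)) => n.
have [v Vv vle] := ag (8^-1 ^+ n) (pow8_gt0 n).
have Lv := VL _ Vv.
have -> : dot g h = dot (g - v) h by rewrite dotBl // (H v Vv) subr0.
rewrite (le_trans (cauchy_schwarz _ _)) //; try l2.
by rewrite mulrC ler_wpM2l // nsq_ge0.
Qed.

(** A minimising sequence for the distance from [f] to [V] is Cauchy by the
    parallelogram law, and the residue of its limit is orthogonal to [V]. *)
Lemma approximation V f : subspace V -> L2 f ->
  exists g, [/\ L2 g, adherent V g & forall v, V v -> dot (f - g) v = 0].
Proof.
move=> [VL V0 VD] Lf.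
pose S := [set nsq (f - v) | v in V].
have S0 : S !=set0 by exists (nsq (f - 0)); exists 0.
have lbS : has_lbound S by exists 0 => _ [v _ <-]; exact: nsq_ge0.
have hi : has_inf S by [].
pose D := inf S.
have Dle v : V v -> D <= nsq (f - v) by move=> Vv; apply: ge_inf => //; exists v.
have p8 n : 0 < 8^-1 ^+ n / 4 :> R by rewrite divr_gt0 // pow8_gt0.
have /choice[s Hs] : forall n, exists v, V v /\ nsq (f - v) <= D + 8^-1 ^+ n / 4.
  move=> n; have [_ [v Vv <-] vlt] := inf_adherent (p8 n) hi.
  by exists v; split => //; exact: ltW.
have Vs n := (Hs n).1; have Ls n : L2 (s n) by exact: VL.
have steps n : nsq (s n.+1 - s n) <= 8^-1 ^+ n.
  (* The midpoint of two terms is no closer to [f] than the infimum. *)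
  pose m := s n + cst 2^-1 * (s n.+1 - s n).
  have Vm : V m.
    have -> : m = s n + cst 2^-1 * s n.+1 + cst (- 2^-1) * s n.
      by rewrite /m cstN; ring.
    by apply: (VD) => //; apply: (VD).
  have Lm := VL _ Vm.
  have Ln : L2 (f - s n) by l2.
  have Ln1 : L2 (f - s n.+1) by l2.
  have := parallelogram Ln Ln1.
  have -> : f - s n - (f - s n.+1) = s n.+1 - s n by ring.
  have -> : f - s n + (f - s n.+1) = cst 2 * (f - m).
    by apply/funext => t; rewrite /m !fctE; field.
  have Lfm : L2 (f - m) by l2.
  have -> : nsq (cst 2 * (f - m)) = 4 * nsq (f - m).
    rewrite (nsqZ 2 Lfm) (_ : sqc 2 = 4) // /sqc /=; ring.
  have := Dle _ Vm; have := (Hs n).2; have := (Hs n.+1).2.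
  rewrite exprS; have := p8 n; lra.
have [g Lg Hg] := L2_complete Ls steps.
have ag : adherent V g.
  move=> e e0; have [n Hn] := @expr_small e 3 e0.
  by exists (s n) => //; apply: le_trans Hn.
exists g; split => // w Vw; have Lw := VL _ Vw.
(* By minimality every quadratic polynomial in [quad_bound] is nonnegative
   once the excess of [s n] over the infimum is added. *)
have near_orth n : sqc (dot (f - s n) w) <= 8^-1 ^+ n / 4 * nsq w.
  apply: quad_bound; rewrite ?sqc_ge0 ?nsq_ge0 ?ltW // => r.
  have := Dle _ (VD (r%:C%C * dot (f - s n) w) _ _ (Vs n) Vw).
  have -> : f - (s n + cst (r%:C%C * dot (f - s n) w) * w) =
            f - s n - cst (r%:C%C * dot (f - s n) w) * w by ring.
  have Ln : L2 (f - s n) by l2.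
  rewrite (nsq_sub_dot r Ln Lw).
  have := (Hs n).2; lra.
apply/eqP; rewrite -sqc_eq0 eq_le sqc_ge0 andbT.
apply: (@small_le0 _ (7 * nsq w)) => n.
have -> : dot (f - g) w = dot (f - s n) w - dot (g - s n) w.
  by rewrite !dotBl //; ring.
have h1 := near_orth n; have Ld : L2 (g - s n) by l2.
have h2 := cauchy_schwarz Ld Lw.
have h3 : nsq (g - s n) * nsq w <= 3 * 8^-1 ^+ n * nsq w.
  by rewrite ler_wpM2r ?nsq_ge0.
have h4 : 0 <= 8^-1 ^+ n * nsq w by rewrite mulr_ge0 ?nsq_ge0 // ltW // pow8_gt0.
have h5 (a b : R[i]) : sqc (a - b) <= 2 * sqc a + 2 * sqc b.
  rewrite /sqc !ReImE.
  have := sqr_ge0 (complex.Re a + complex.Re b).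
  have := sqr_ge0 (complex.Im a + complex.Im b); nra.
apply: le_trans (h5 _ _) _; nra.
Qed.

End Approximation.

(** * The measure of the circle *)

Section CircleMeasure.
Import numFieldNormedType.Exports.
Variable R : realType.
Notation mu := (circle_measure R).
Notation leb := (@lebesgue_measure R).

Lemma integral_circle (h : R -> \bar R) : measurable_fun setT h ->
  (\int[mu]_t h t = \int[leb]_(t in `[0%R, 1%R]) h t)%E.
Proof.
move=> mh; rewrite [LHS]integralE [RHS]integralE.
have cst1 : ((1 - 0 : R)^-1%:E = 1)%E by rewrite subr0 invr1.
congr (_ - _)%E.
  rewrite (@integral_uniform R 0 1 ltr01) ?cst1 ?mul1e //.
  exact: measurable_funepos.
rewrite (@integral_uniform R 0 1 ltr01) ?cst1 ?mul1e //.
exact: measurable_funeneg.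
Qed.

Lemma ae_lebesgue_circle (P : R -> Prop) :
  {ae leb, forall t, P t} -> {ae mu, forall t, P t}.
Proof.
move=> [N [mN N0 sN]]; exists N; split => //.
have /null_content_dominatesP dom := dominates_uniform_prob (@ltr01 R).
exact: dom.
Qed.

Lemma ae_circle_neq (x : R) : {ae mu, forall t, t != x}.
Proof.
apply: ae_lebesgue_circle; exists [set x]; split => //.
  exact: lebesgue_measure_set1.
by move=> t /= /negP/negPn/eqP.
Qed.

Lemma ae_circle_itv : {ae mu, forall t, 0 < t < 1}.
Proof.
have h : {ae mu, forall t, 0 <= t <= 1}.
  exists (~` `[0, 1]); split; first exact: measurableC.
    rewrite /= /uniform_prob integral_uniform_pdf setIC setICr integral_set0 //.
  by move=> t /=; rewrite in_itv.
have h2 : {ae mu, forall t, t != 0 /\ t != 1}.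
  by apply: aeS2 (ae_circle_neq 0) (ae_circle_neq 1) => t.
apply: aeS2 h h2 => t /andP[t0 t1] [n0 n1].
by rewrite !lt_neqAle t0 t1 n1 eq_sym n0.
Qed.

Lemma integrable_circle (h : R -> \bar R) : mu.-integrable setT h ->
  leb.-integrable `[0%R, 1%R] h.
Proof.
move=> /integrableP[mh hoo]; apply/integrableP; split.
  exact: measurable_funTS.
by rewrite -integral_circle //; exact: measurableT_comp.
Qed.

(** The indefinite integral of an integrable function determines it, by
    Lebesgue differentiation. *)
Lemma integral_rays_ae0 (h : R -> R) : mu.-integrable setT (EFin \o h) ->
  (forall x, (\int[mu]_t (h t * \1_(`]-oo, x]) t)%:E = 0)%E) ->
  {ae mu, forall t, h t = 0}.
Proof.
move=> ih H; have mh : measurable_fun setT h.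
  by apply/measurable_EFinP; exact: (measurable_int mu).
pose k := h \_ `[0, 1].
have mI : measurable (`[0, 1]%classic : set R) by exact: measurable_itv.
have ik : leb.-integrable setT (EFin \o k).
  rewrite -restrict_EFin.
  exact: (@integrable_mkcond _ (measurableTypeR R) R leb _ _ mI).1 (integrable_circle ih).
have lk : locally_integrable setT k.
  by apply: integrable_locally_restrict => //; exact: integrable_circle.
have iky y : leb.-integrable `]-oo, y] (EFin \o k).
  by apply: integrableS ik => //; exact: measurable_itv.
have F0 y : (\int[leb]_(t in `]-oo, y]) k t)%R = 0.
  rewrite /Rintegral.
  rewrite (_ : (\int[leb]_(t in `]-oo, y]) (k t)%:E = 0)%E) //.
  have mJ : measurable (`]-oo, y]%classic : set R).
    exact: measurable_itv.
  have mi : measurable_fun setT (\1_(`]-oo, y]) : R -> R) by exact: measurable_indic.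
  have mhJ : measurable_fun setT (fun t => (h t * \1_(`]-oo, y]) t)%:E).
    apply/measurable_EFinP; exact: measurable_funM mh mi.
  rewrite -(H y) (integral_circle mhJ).
  rewrite [LHS]integral_mkcond [RHS]integral_mkcond; apply: eq_integral => t _.
  rewrite !patchE /k patchE indicE.
  by case: (_ \in _); case: (_ \in _); rewrite ?mulr1 ?mulr0.
have k0 : {ae leb, forall t, k t = 0}.
  apply: (@aeS _ (measurableTypeR R) R leb _ _ _ (FTC1Ny iky lk)) => t [_ <-].
  rewrite (_ : (fun x => _) = cst 0); last exact/funext.
  by rewrite derive1_cst.
have k0' := ae_lebesgue_circle k0.
apply: aeS2 ae_circle_itv k0' => t /andP[t0 t1].
by rewrite /k patchE mem_set //= in_itv /= !ltW.
Qed.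

End CircleMeasure.

(** * Uniqueness of Fourier coefficients *)

Section Steps.
Import numFieldNormedType.Exports.
Variable R : realType.

Lemma bernoulli_le (a : R) m : -1 <= a -> 1 + m%:R * a <= (1 + a) ^+ m.
Proof.
move=> a1; elim: m => [|m IH]; first by rewrite mul0r addr0 expr0.
rewrite exprS -natr1; have : 0 <= (1 + a) * ((1 + a) ^+ m - (1 + m%:R * a)).
  by rewrite mulr_ge0 ?subr_ge0 //; lra.
have : 0 <= m%:R * a ^+ 2 by rewrite mulr_ge0 // sqr_ge0.
lra.
Qed.

Lemma pow2_expr (y : R) n : (2 ^ n)%:R * y ^+ n = (2 * y) ^+ n.
Proof. by rewrite natrX exprMn. Qed.

Lemma geometric_cvg0 (r : R) : `|r| < 1 -> (fun n => r ^+ n) @ \oo --> (0 : R).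
Proof.
move=> r1; have := @cvg_geometric R 1 _ r1.
by rewrite (_ : geometric 1 r = fun n => r ^+ n) //; apply/funext => n /=; rewrite mul1r.
Qed.

(** The classical steep polynomials: on [0, 1] they converge to the indicator
    of the points below one half. *)
Lemma steep_below (y : R) : 0 <= y < 2^-1 ->
  (fun n => (1 - y ^+ n) ^+ (2 ^ n)) @ \oo --> (1 : R).
Proof.
move=> /andP[y0 y2].
have hg : `|2 * y| < 1 by rewrite ger0_norm; lra.
have g0 := geometric_cvg0 hg.
have g1 : (fun n => 1 - (2 * y) ^+ n) @ \oo --> (1 : R).
  rewrite -[X in _ --> X]subr0; apply: cvgB => //; exact: cvg_cst.
apply: squeeze_cvgr g1 (cvg_cst _).
apply: nearW => n.
have yn : 0 <= y ^+ n <= 1.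
  by rewrite exprn_ge0 // exprn_ile1 //; lra.
apply/andP; split; last by rewrite exprn_ile1 //; lra.
rewrite -pow2_expr; have := @bernoulli_le (- y ^+ n) (2 ^ n).
by rewrite mulrN; apply; lra.
Qed.

(** Here [(1 - y ^+ n) (1 + y ^+ n) <= 1], and the inequality of Bernoulli
    makes the power of the second factor at least [(2 y) ^+ n]. *)
Lemma steep_above (y : R) : 2^-1 < y <= 1 ->
  (fun n => (1 - y ^+ n) ^+ (2 ^ n)) @ \oo --> (0 : R).
Proof.
move=> /andP[y2 y1].
have yp : 0 < 2 * y by lra.
have hg : `|(2 * y)^-1| < 1.
  by rewrite ger0_norm ?invr_ge0 ?invf_lt1 //; lra.
have g0 := geometric_cvg0 hg.
apply: squeeze_cvgr (cvg_cst 0) g0.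
apply: nearW => n.
have y0 : 0 <= y by lra.
have yn : 0 <= y ^+ n <= 1 by rewrite exprn_ge0 // exprn_ile1.
apply/andP; split; first by rewrite exprn_ge0 //; lra.
rewrite exprVn -[_^-1]mul1r ler_pdivlMr ?exprn_gt0 // -pow2_expr.
apply: (@le_trans _ _ ((1 - y ^+ n) ^+ (2 ^ n) * (1 + y ^+ n) ^+ (2 ^ n))).
  rewrite ler_wpM2l //; first by rewrite exprn_ge0 //; lra.
  have := @bernoulli_le (y ^+ n) (2 ^ n); lra.
rewrite -exprMn exprn_ile1 //; nra.
Qed.

End Steps.

Section DominatedZero.
Import numFieldNormedType.Exports.
Context d (T : measurableType d) (R : realType) (mu : {measure set T -> \bar R}).

Lemma dominated_integral0 (h : T -> R) (p_ : nat -> T -> R) (p : T -> R) :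
  mu.-integrable setT (EFin \o h) ->
  (forall n, measurable_fun setT (p_ n)) -> measurable_fun setT p ->
  (forall n t, `|p_ n t| <= 1) ->
  {ae mu, forall t, p_ ^~ t @ \oo --> p t} ->
  (forall n, (\int[mu]_t (h t * p_ n t)%:E = 0)%E) ->
  (\int[mu]_t (h t * p t)%:E = 0)%E.
Proof.
move=> ih mp_ mp p1 cv H.
have mh : measurable_fun setT h by apply/measurable_EFinP; exact: (measurable_int mu).
have [] := @dominated_convergence _ T R mu setT measurableT
  (fun n t => (h t * p_ n t)%:E) (fun t => (h t * p t)%:E) (fun t => `|h t|%:E).
- by move=> n; apply/measurable_EFinP; exact: measurable_funM.
- by apply/measurable_EFinP; exact: measurable_funM.
- apply: filterS cv => t ct _; apply: cvg_EFin; first exact: nearW.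
  by apply: cvgM => //; exact: cvg_cst.
- exact: integrable_norm.
- apply: aeW => t n _; rewrite /= lee_fin normrM.
  by rewrite -[leRHS]mulr1 ler_wpM2l.
move=> _ _ /cvg_lim => /(_ (@ereal_hausdorff R)) <-.
rewrite (_ : (fun n => _) = cst 0%E) ?lim_cst //; last exact/funext.
Qed.

End DominatedZero.

Section Fourier.
Import numFieldNormedType.Exports.
Variable R : realType.
Notation mu := (circle_measure R).
Notation z := (@zvar R).
Implicit Types f g h p : circle_fun R.

Lemma measurable_trig (c : R) :
  measurable_fun setT (fun t => cos (c * t)) /\
  measurable_fun setT (fun t => sin (c * t)).
Proof.
have mc : measurable_fun setT (fun t : R => c * t) by exact: measurable_funM.
split.
  apply: (measurableT_comp _ mc); apply: continuous_measurable_fun.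
  exact: continuous_cos.
apply: (measurableT_comp _ mc); apply: continuous_measurable_fun.
exact: continuous_sin.
Qed.

Lemma sqmod_zvar t : sqmod z t = 1.
Proof. by rewrite /sqmod /= cos2Dsin2. Qed.
Lemma bd_zvar : ess_bounded z.
Proof.
split; first exact: (measurable_trig (2 * pi)).
by exists 1; apply: aeW => t; rewrite sqmod_zvar.
Qed.
Lemma zJz : conjf z * z = 1.
Proof.
apply/funext => t; apply: complexP; rewrite /conjf !fctE !ReImE /=.
  by rewrite mulNr opprK -!expr2 cos2Dsin2.
ring.
Qed.
Lemma zvarX n t :
  (z ^+ n) t = (cos (n%:R * (2 * pi) * t) +i* sin (n%:R * (2 * pi) * t))%C.
Proof.
elim: n => [|n IH]; first by rewrite !mul0r cos0 sin0.
rewrite exprS; change ((z * z ^+ n) t) with (z t * (z ^+ n) t); rewrite IH.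
have -> : n.+1%:R * (2 * pi) * t = 2 * pi * t + n%:R * (2 * pi) * t.
  by rewrite -natr1; ring.
rewrite cosD sinD; apply: complexP; rewrite !ReImE /=; ring.
Qed.

Lemma cos_sin_period n : cos (n%:R * (2 * pi)) = 1 :> R /\
  sin (n%:R * (2 * pi)) = 0 :> R.
Proof.
elim: n => [|n [c s]]; first by rewrite mul0r cos0 sin0.
have -> : n.+1%:R * (2 * pi) = n%:R * (2 * pi) + pi *+ 2 :> R.
  by rewrite -natr1 -[pi *+ 2]mulr_natl; ring.
by rewrite cosD2pi sinD2pi.
Qed.

(** A derivative of a periodic function has mean zero. *)
Lemma integral_periodic (F f : R -> R) : continuous f ->
  (forall x : R, is_derive x (1 : R) F (f x)) -> F 0 = F 1 ->
  (\int[mu]_t f t)%R = 0.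
Proof.
move=> cf dF F01.
have mf : measurable_fun setT (EFin \o f).
  by apply/measurable_EFinP; exact: continuous_measurable_fun.
rewrite /Rintegral integral_circle //.
have cF x : {for x, continuous F}.
  by apply/differentiable_continuous/derivable1_diffP; case: (dF x).
rewrite (@continuous_FTC2 _ f F 0 1) // ?F01 -?EFinB ?subrr //.
- exact: continuous_subspaceT.
- split=> [x _||]; first by case: (dF x).
    exact: cvg_at_right_filter (cF 0).
  exact: cvg_at_left_filter (cF 1).
- by move=> x _; rewrite derive1E; exact: derive_val.
Qed.

Lemma is_derive_rescaled (G : R -> R) (g : R -> R) (c x : R) : c != 0 ->
  (forall y : R, is_derive y (1 : R) G (g y)) ->
  is_derive x (1 : R) (fun t => c^-1 * G (c * t)) (g (c * x)).
Proof.
move=> c0 dG.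
have dl : is_derive x (1 : R) (c \*: (id : R -> R)) c.
  by apply: is_derive_eq; rewrite /GRing.scale /= mulr1.
have dGl : is_derive x (1 : R) (G \o (c \*: (id : R -> R))) (g (c * x) * c).
  exact: is_derive1_comp.
have -> : (fun t => c^-1 * G (c * t)) = c^-1 \*: (G \o (c \*: (id : R -> R))).
  by apply/funext.
apply: is_derive_eq; rewrite /GRing.scale /=; field.
by [].
Qed.

Lemma cintegral_zvarX n : cintegral (z ^+ n.+1) = 0.
Proof.
pose c : R := n.+1%:R * (2 * pi).
have c0 : c != 0 by rewrite mulf_neq0 ?pnatr_eq0 // mulf_neq0 // gt_eqF // pi_gt0.
have [cc cs] := cos_sin_period n.+1.
have cl : continuous (fun t : R => c * t).
  by move=> x; apply: cvgM; [exact: cvg_cst|exact: cvg_id].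
apply: complexP => /=.
  under eq_Rintegral do rewrite zvarX /=.
  apply: (@integral_periodic (fun t => c^-1 * sin (c * t))) => [x|x|].
  - by apply: continuous_comp; [exact: cl|exact: continuous_cos].
  - exact: is_derive_rescaled.
  - by rewrite mulr0 mulr1 sin0 /c cs.
under eq_Rintegral do rewrite zvarX /=.
apply: (@integral_periodic (fun t => c^-1 * - cos (c * t))) => [x|x|].
- by apply: continuous_comp; [exact: cl|exact: continuous_sin].
- apply: (@is_derive_rescaled (fun y => - cos y) sin) => // y.
  by apply: is_derive_eq; rewrite opprK.
- by rewrite mulr0 mulr1 cos0 /c cc.
Qed.

(** The coordinate function, sealed so that comparing it with its conjugate
    never unfolds cosines and sines into power series. *)
Fact coord_key : unit. Proof. by []. Qed.
Definition coord : circle_fun R := locked_with coord_key z.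
Lemma coordE : coord = z. Proof. exact: unlock. Qed.
Lemma bd_coord : ess_bounded coord. Proof. by rewrite coordE; exact: bd_zvar. Qed.
Lemma coordJcoord : conjf coord * coord = 1. Proof. by rewrite coordE zJz. Qed.
Lemma coordcoordJ : coord * conjf coord = 1. Proof. by rewrite mulrC coordJcoord. Qed.
Lemma cintegral_coordX n : cintegral (coord ^+ n.+1) = 0.
Proof. by rewrite coordE cintegral_zvarX. Qed.

End Fourier.
#[export] Hint Resolve bd_coord : l2.

Section Uniqueness.
Import numFieldNormedType.Exports.
Variable R : realType.
Notation mu := (circle_measure R).
Notation z := (@coord R).
Implicit Types f g h p : circle_fun R.

Definition null_coefs f := L2 f /\
  forall n, cintegral (f * z ^+ n) = 0 /\ cintegral (f * conjf z ^+ n) = 0.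

(** Multipliers preserving the vanishing of all Fourier coefficients; they
    form an algebra, which spares any explicit trigonometric polynomial. *)
Definition coef_multiplier p := ess_bounded p /\
  forall f, null_coefs f -> null_coefs (p * f).

Lemma mult_cst a : coef_multiplier (cst a).
Proof.
split; first exact: bd_cst.
move=> f [Lf H]; split; first by apply: L2Z.
move=> n.
have L1z : L1 (f * z ^+ n) by apply: L1_mul; l2.
have L1zJ : L1 (f * conjf z ^+ n) by apply: L1_mul; l2.
have E (p : circle_fun R) : (cst a : circle_fun R) * f * p = (cst a : circle_fun R) * (f * p).
  by rewrite mulrA.
have Z (p : circle_fun R) : L1 (f * p) -> cintegral (f * p) = 0 ->
    cintegral ((cst a : circle_fun R) * f * p) = 0.
  by move=> Lp p0; rewrite E cintegralZ // p0 mulr0.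
by split; apply: Z => //; case: (H n).
Qed.
Lemma mult_z : coef_multiplier z.
Proof.
split; first exact: bd_coord.
move=> f [Lf H]; split; first by l2.
have E n : z * f * z ^+ n = f * z ^+ n.+1 by rewrite exprS; ring.
case=> [|n]; (split; first by rewrite E; exact: (H _).1).
  by apply: etrans (H 1%N).1; congr cintegral; rewrite expr0 expr1; ring.
apply: etrans (H n).2; congr cintegral.
by rewrite exprS -[RHS]mul1r -coordcoordJ; ring.
Qed.
Lemma mult_zJ : coef_multiplier (conjf z).
Proof.
split; first by bd.
move=> f [Lf H]; split; first by l2.
have E n : conjf z * f * conjf z ^+ n = f * conjf z ^+ n.+1 by rewrite exprS; ring.
case=> [|n]; (split; last by rewrite E; exact: (H _).2).
  by apply: etrans (H 1%N).2; congr cintegral; rewrite expr0 expr1; ring.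
apply: etrans (H n).1; congr cintegral.
by rewrite exprS -[RHS]mul1r -coordJcoord; ring.
Qed.
Lemma multM p q : coef_multiplier p -> coef_multiplier q -> coef_multiplier (p * q).
Proof.
move=> [bp Hp] [bq Hq]; split; first exact: bdM.
by move=> f nf; rewrite -mulrA; apply: Hp; exact: Hq.
Qed.
Lemma multD p q : coef_multiplier p -> coef_multiplier q -> coef_multiplier (p + q).
Proof.
move=> [bp Hp] [bq Hq]; split; first exact: bdD.
move=> f nf; have [Lpf H1] := Hp _ nf; have [Lqf H2] := Hq _ nf.
rewrite mulrDl; split; first by l2.
move=> n.
have key w : ess_bounded w -> cintegral (p * f * w) = 0 ->
    cintegral (q * f * w) = 0 -> cintegral ((p * f + q * f) * w) = 0.
  move=> bw pw qw; rewrite mulrDl cintegralD ?pw ?qw ?addr0 //.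
    by apply: L1_mul; l2.
  by apply: L1_mul; l2.
by split; apply: key; [bd|exact: (H1 n).1|exact: (H2 n).1
                      |bd|exact: (H1 n).2|exact: (H2 n).2].
Qed.
Lemma multX p n : coef_multiplier p -> coef_multiplier (p ^+ n).
Proof.
move=> Hp; elim: n => [|n IH]; first exact: (mult_cst 1).
by rewrite exprS; exact: multM.
Qed.

End Uniqueness.

Section FourierUniqueness.
Import numFieldNormedType.Exports.
Variable R : realType.
Notation mu := (circle_measure R).
Notation z := (@coord R).
Implicit Types f g h p : circle_fun R.

(** On the circle this trigonometric polynomial of degree one exceeds one half
    exactly on the arc from 0 to [x]. *)
Definition arc_fun (x t : R) : R :=
  2^-1 + (cos (2 * pi * t - pi * x) - cos (pi * x)) / 4.

Lemma arc_fun_itv x t : 0 <= arc_fun x t <= 1.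
Proof.
have := cos_le1 (2 * pi * t - pi * x); have := cos_geN1 (2 * pi * t - pi * x).
have := cos_le1 (pi * x); have := cos_geN1 (pi * x).
rewrite /arc_fun; set a := cos _; set b := cos _ => *; apply/andP; split; lra.
Qed.

(** The difference of cosines factors, and for [t] and [x] between 0 and 1
    the sign of the product is that of [x - t]. *)
Lemma arc_funE x t : arc_fun x t = 2^-1 + sin (pi * t) * sin (pi * (x - t)) / 2.
Proof.
rewrite /arc_fun; have -> : 2 * pi * t - pi * x = pi * t - pi * (x - t) by ring.
have -> : pi * x = pi * t + pi * (x - t) by ring.
by rewrite cosB cosD; field.
Qed.

Lemma arc_fun_gt x t : 0 < t < 1 -> 0 < x < 1 -> t < x -> 2^-1 < arc_fun x t.
Proof.
move=> /andP[t0 t1] /andP[x0 x1] tx; have := pi_gt0 R => p0.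
rewrite arc_funE ltrDl divr_gt0 // mulr_gt0 //; apply: sin_gt0_pi.
  by rewrite mulr_gt0 //= -[ltRHS]mulr1 ltr_pM2l.
rewrite mulr_gt0 ?subr_gt0 //= -[ltRHS]mulr1 ltr_pM2l //; lra.
Qed.

Lemma arc_fun_lt x t : 0 < t < 1 -> 0 < x < 1 -> x < t -> arc_fun x t < 2^-1.
Proof.
move=> /andP[t0 t1] /andP[x0 x1] xt; have := pi_gt0 R => p0.
have -> : 2^-1 = 2^-1 + 0 :> R by rewrite addr0.
rewrite arc_funE ltrD2l -(opprB t x) mulrN sinN mulrN mulNr oppr_lt0.
rewrite divr_gt0 // mulr_gt0 //; apply: sin_gt0_pi.
  by rewrite mulr_gt0 //= -[ltRHS]mulr1 ltr_pM2l.
rewrite mulr_gt0 ?subr_gt0 //= -[ltRHS]mulr1 ltr_pM2l //; lra.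
Qed.

Definition arc_step n x t : R := 1 - (1 - arc_fun x t ^+ n) ^+ (2 ^ n).

Lemma mult_arc_fun x : coef_multiplier (fun t => (arc_fun x t)%:C%C : R[i]).
Proof.
pose w : R[i] := (cos (pi * x) / 8 -i* (sin (pi * x) / 8))%C.
have -> : (fun t => (arc_fun x t)%:C%C) =
    cst ((2^-1 - cos (pi * x) / 4)%:C%C) + (cst w * z + cst (w^*)%C * conjf z)
    :> circle_fun R.
  apply/funext => t; rewrite coordE /conjf !fctE; apply: complexP.
    by rewrite !ReImE /= /arc_fun cosB; field.
  by rewrite !ReImE /=; field.
apply: multD; first exact: mult_cst.
by apply: multD; apply: multM; [exact: mult_cst|exact: mult_z
                               |exact: mult_cst|exact: mult_zJ].
Qed.

Lemma mult_arc_step n x : coef_multiplier (fun t => (arc_step n x t)%:C%C : R[i]).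
Proof.
set y := fun t => (arc_fun x t)%:C%C : R[i].
have -> : (fun t => (arc_step n x t)%:C%C) =
    cst 1 + cst (- 1) * (cst 1 + cst (- 1) * (y : circle_fun R) ^+ n) ^+ (2 ^ n)
    :> circle_fun R.
  apply/funext => t; rewrite /arc_step !fctE /y.
  by rewrite rmorphB rmorphXn /= rmorphB rmorphXn /= rmorph1 !mulN1r.
have M := mult_arc_fun x; have c := @mult_cst R.
apply: multD => //; apply: multM => //; apply: multX.
by apply: multD => //; apply: multM => //; exact: multX.
Qed.

Lemma arc_step_norm n x t : `|arc_step n x t| <= 1.
Proof.
have /andP[y0 y1] := arc_fun_itv x t.
have yn : 0 <= arc_fun x t ^+ n <= 1 by rewrite exprn_ge0 // exprn_ile1.
have : 0 <= (1 - arc_fun x t ^+ n) ^+ (2 ^ n) <= 1.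
  by rewrite exprn_ge0 ?exprn_ile1 //; lra.
rewrite /arc_step; set q := _ ^+ (2 ^ n) => hq.
by rewrite ler_norml; lra.
Qed.

Lemma arc_step_cvg x t : 0 < x < 1 -> 0 < t < 1 -> t != x ->
  (fun n => arc_step n x t) @ \oo --> (\1_(`]-oo, x]) t : R).
Proof.
move=> x01 t01 ntx; have /andP[y0 y1] := arc_fun_itv x t.
rewrite indicE; have [tx|xt|/eqP] := ltgtP t x; last by rewrite (negbTE ntx).
  rewrite mem_set /=; last by rewrite in_itv /= ltW.
  rewrite -[X in _ --> X]subr0; apply: cvgB; first exact: cvg_cst.
  by apply: steep_above; rewrite y1 arc_fun_gt.
rewrite memNset /=; last by rewrite in_itv /= leNgt xt.
rewrite -[X in _ --> X](subrr 1); apply: cvgB; first exact: cvg_cst.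
by apply: steep_below; rewrite y0 arc_fun_lt.
Qed.

Lemma integral_0 (h : R -> R) : mu.-integrable setT (EFin \o h) ->
  (\int[mu]_t h t)%R = 0 -> (\int[mu]_t (h t)%:E = 0)%E.
Proof.
move=> ih; rewrite /Rintegral => h0.
by rewrite -(fineK (integrable_fin_num measurableT ih)) h0.
Qed.

(** Applied to the real and to the imaginary part of a function with vanishing
    Fourier coefficients: the integral over each initial arc is the limit of
    the integrals against the arc steps. *)
Lemma component_ae0 (h : R -> R) : mu.-integrable setT (EFin \o h) ->
  (\int[mu]_t h t)%R = 0 ->
  (forall n x, (\int[mu]_t (h t * arc_step n x t)%:E = 0)%E) ->
  {ae mu, forall t, h t = 0}.
Proof.
move=> ih h0 H.
have mh : measurable_fun setT h.
  by apply/measurable_EFinP; exact: (measurable_int mu).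
have mstep n x : measurable_fun setT (arc_step n x).
  exact: (mult_arc_step n x).1.1.1.
have mi (x : R) : measurable_fun setT (\1_(`]-oo, x]) : R -> R).
  exact: measurable_indic.
have mhi (x : R) : measurable_fun setT (fun t => (h t * \1_(`]-oo, x]) t)%:E).
  by apply/measurable_EFinP; exact: measurable_funM mh (mi x).
apply: integral_rays_ae0 => // x.
(* Rays that end outside the unit interval see nothing, or all of it. *)
have [x0|x0] := leP x 0.
  rewrite -[RHS](@integral0 _ (measurableTypeR R) R mu setT).
  apply: (@eq_integral_ae _ (measurableTypeR R) R mu) => //; first exact: mhi.
  apply: aeS (ae_circle_itv R) => t /andP[t0 t1].
  rewrite indicE memNset ?mulr0 //= in_itv /= => tx.
  by have := lt_le_trans t0 (le_trans tx x0); rewrite ltxx.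
have [x1|x1] := leP 1 x.
  rewrite -(integral_0 ih h0).
  apply: (@eq_integral_ae _ (measurableTypeR R) R mu) => //; first exact: mhi.
    exact/measurable_EFinP.
  apply: aeS (ae_circle_itv R) => t /andP[t0 t1].
  by rewrite indicE mem_set ?mulr1 //= in_itv /= ltW // (lt_le_trans t1).
apply: (@dominated_integral0 _ (measurableTypeR R) R mu h
  (fun n => arc_step n x)) => //.
- by move=> n; exact: mstep.
- by move=> n t; exact: arc_step_norm.
- apply: aeS2 (ae_circle_itv R) (ae_circle_neq x) => t t01 tx.
  by apply: arc_step_cvg => //; rewrite x0.
Qed.

Theorem null_coefs_ae0 f : null_coefs f -> f = 0 %[ae mu].
Proof.
move=> nf; have [Lf H] := nf; have [fr fi] := L2_L1 Lf.
have step n x : L1 ((fun t => (arc_step n x t)%:C%C) * f) /\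
    cintegral ((fun t => (arc_step n x t)%:C%C) * f) = 0.
  have [bs Hs] := mult_arc_step n x; have [Ls Hs0] := Hs _ nf.
  split; first exact: L2_L1.
  by have := (Hs0 0%N).1; rewrite expr0 mulr1.
have := (H 0%N).1; rewrite expr0 mulr1 => f0.
have r0 : {ae mu, forall t, complex.Re (f t) = 0}.
  apply: component_ae0 => //; first by have := congr1 (@complex.Re R) f0.
  move=> n x; have [[sr _] s0] := step n x.
  transitivity (\int[mu]_t (complex.Re (((fun t => (arc_step n x t)%:C%C) * f) t))%:E)%E.
    apply: eq_integral => t _; congr EFin.
    change (complex.Re (f t) * arc_step n x t = complex.Re ((arc_step n x t)%:C%C * f t)).
    by rewrite cReM /= mul0r subr0 mulrC.
  by apply: integral_0 => //; have := congr1 (@complex.Re R) s0.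
have i0 : {ae mu, forall t, complex.Im (f t) = 0}.
  apply: component_ae0 => //; first by have := congr1 (@complex.Im R) f0.
  move=> n x; have [[_ si] s0] := step n x.
  transitivity (\int[mu]_t (complex.Im (((fun t => (arc_step n x t)%:C%C) * f) t))%:E)%E.
    apply: eq_integral => t _; congr EFin.
    change (complex.Im (f t) * arc_step n x t = complex.Im ((arc_step n x t)%:C%C * f t)).
    by rewrite cImM /= mul0r addr0 mulrC.
  by apply: integral_0 => //; have := congr1 (@complex.Im R) s0.
by apply: aeS2 r0 i0 => t rt it _; apply: complexP.
Qed.

End FourierUniqueness.

(** * The Hardy space *)

Section Hardy.
Variable R : realType.
Notation mu := (circle_measure R).
Notation z := (@coord R).
Implicit Types f g h F G u : circle_fun R.

(** The value at the origin of the analytic extension, by [disc_ext0]. *)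
Definition at0 f : R[i] := dot f 1.

Lemma disc_ext0 f : disc_ext f 0 = at0 f.
Proof.
rewrite /disc_ext /at0 /dot; congr cintegral; apply/funext => t.
by rewrite mulr0 subr0 divr1 conjf1 mulr1.
Qed.

Lemma H2P f : H2 f <-> L2 f /\ forall n, dot f (conjf z ^+ n.+1) = 0.
Proof.
by rewrite /H2 /= -coordE; split=> -[Lf H]; split => // n;
  have := H n; rewrite conjfX.
Qed.
Lemma H2_L2 f : H2 f -> L2 f. Proof. by case. Qed.
#[local] Hint Resolve H2_L2 : l2.

Lemma H2_neg f n : H2 f -> dot f (conjf z ^+ n.+1) = 0.
Proof. by move=> /H2P[]. Qed.
Lemma H2_neg1 f : H2 f -> dot f (conjf z) = 0.
Proof. by move=> /H2_neg => /(_ 0%N). Qed.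

Lemma H2D f g : H2 f -> H2 g -> H2 (f + g).
Proof.
move=> Hf Hg; apply/H2P; split; first by l2.
by move=> n; rewrite dotDl ?H2_neg ?addr0 //; l2.
Qed.
Lemma H2Z a f : H2 f -> H2 (cst a * f).
Proof.
move=> Hf; apply/H2P; split; first by l2.
by move=> n; rewrite dotZl ?H2_neg ?mulr0 //; l2.
Qed.
Lemma H2N f : H2 f -> H2 (- f).
Proof. by move=> Hf; rewrite -mulN1r; exact: (H2Z (-1)). Qed.
Lemma H2B f g : H2 f -> H2 g -> H2 (f - g).
Proof. by move=> Hf Hg; apply: H2D => //; exact: H2N. Qed.
Lemma H2_1 : H2 (1 : circle_fun R).
Proof.
apply/H2P; split; first by l2.
move=> n; rewrite /dot mul1r conjfX conjfK; exact: cintegral_coordX.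
Qed.
Lemma H2_cst a : H2 (cst a : circle_fun R).
Proof. by rewrite -[cst a]mulr1; apply: H2Z; exact: H2_1. Qed.
Lemma H2_zmul f : H2 f -> H2 (z * f).
Proof.
move=> Hf; apply/H2P; split; first by l2.
by move=> n; rewrite dot_move -exprS H2_neg.
Qed.

Lemma at0B f g : L2 f -> L2 g -> at0 (f - g) = at0 f - at0 g.
Proof. by move=> Lf Lg; rewrite /at0 dotBl //; l2. Qed.
Lemma at0Z a f : L2 f -> at0 (cst a * f) = a * at0 f.
Proof. by move=> Lf; rewrite /at0 dotZl //; l2. Qed.
Lemma at0_1 : at0 1 = 1.
Proof.
rewrite /at0 /dot conjf1 mulr1; apply: complexP => /=.
  have P1 : fine (mu setT) = 1 by have := @probability_setT _ _ _ mu => /= ->.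
  by rewrite (@Rintegral_cst _ (measurableTypeR R) R mu setT measurableT) P1 mul1r.
by rewrite Rintegral_cst // mul0r.
Qed.
Lemma at0_cst a : at0 (cst a) = a.
Proof. by rewrite -[cst a]mulr1 at0Z ?at0_1 ?mulr1 //; l2. Qed.
Lemma at0_z f : H2 f -> at0 (z * f) = 0.
Proof. by move=> Hf; rewrite /at0 dot_move mulr1 H2_neg1. Qed.
Lemma dot_cstl a f : L2 f -> dot (cst a) f = a * ((at0 f)^*)%C.
Proof.
by move=> Lf; rewrite -[cst a]mulr1 dotZl /at0 -?dotC //; l2.
Qed.
Lemma dot_cstr a f : L2 f -> dot f (cst a) = (a^*)%C * at0 f.
Proof. by move=> Lf; rewrite -[cst a]mulr1 dotZr //; l2. Qed.

(** The backward shift. *)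
Definition bshift f : circle_fun R := conjf z * (f - cst (at0 f)).

Lemma L2_bshift f : L2 f -> L2 (bshift f).
Proof. by move=> Lf; rewrite /bshift; l2. Qed.
Lemma z_bshift f : z * bshift f = f - cst (at0 f).
Proof. by rewrite /bshift mulrA coordcoordJ mul1r. Qed.
Lemma H2_bshift f : H2 f -> H2 (bshift f).
Proof.
move=> Hf; apply/H2P; split; first by apply: L2_bshift; l2.
move=> n; have -> : dot (bshift f) (conjf z ^+ n.+1) = dot (f - cst (at0 f)) (conjf z ^+ n).
  rewrite /bshift dot_move conjfK; congr dot.
  by rewrite exprS mulrA coordcoordJ mul1r.
case: n => [|n]; last by apply: H2_neg; apply: H2B => //; exact: H2_cst.
by rewrite expr0 -/(at0 _) at0B ?at0_cst ?subrr //; l2.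
Qed.

Lemma coefs_ae0 f : L2 f -> (forall n, dot f (z ^+ n) = 0) ->
  (forall n, dot f (conjf z ^+ n.+1) = 0) -> f = 0 %[ae mu].
Proof.
move=> Lf Hp Hn; apply: null_coefs_ae0; split => // n; split.
  case: n => [|n]; first by have := Hp 0%N; rewrite /dot !expr0 conjf1.
  by have := Hn n; rewrite /dot conjfX conjfK.
by have := Hp n; rewrite /dot conjfX.
Qed.

(** Defined by its induction principle, so that properties of the linear
    span follow without handling explicit linear combinations. *)
Definition span (B : set (circle_fun R)) : set (circle_fun R) :=
  [set p | forall Q : set (circle_fun R), Q 0 -> B `<=` Q ->
    (forall a f g, Q f -> Q g -> Q (f + cst a * g)) -> Q p].

Lemma sub_span B : B `<=` span B.
Proof. by move=> p Bp Q _ BQ _; exact: BQ. Qed.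
Lemma subspace_span B : B `<=` @L2 R -> subspace (span B).
Proof.
move=> BL; split.
- move=> p; apply; [exact: L2_0|exact: BL|].
  by move=> a f g Lf Lg; l2.
- by move=> Q Q0.
- move=> a f g Bf Bg Q Q0 BQ QD.
  by apply: (QD); [exact: Bf|exact: Bg].
Qed.
Lemma span_orth B h : B `<=` @L2 R -> L2 h -> (forall b, B b -> dot b h = 0) ->
  forall p, span B p -> dot p h = 0.
Proof.
move=> BL Lh H p Bp.
have [] : L2 p /\ dot p h = 0; last by [].
apply: (Bp [set p | L2 p /\ dot p h = 0]).
- by split; [l2|rewrite dot0l].
- by move=> b Bb; split; [exact: BL|exact: H].
- move=> a f g [Lf f0] [Lg g0]; split; first by l2.
  by rewrite dotDl ?dotZl ?f0 ?g0 ?mulr0 ?addr0 //; l2.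
Qed.

Definition monomials : set (circle_fun R) := [set f | exists n, f = z ^+ n].

Lemma monomials_L2 : monomials `<=` @L2 R.
Proof. by move=> _ [n ->]; l2. Qed.

(** The projection on the closed span of the monomials has the same Fourier
    coefficients: those of negative index vanish on both sides. *)
Lemma H2_adherent G : H2 G -> adherent (span monomials) G.
Proof.
move=> HG; have LG := H2_L2 HG.
have [g [Lg ag Hg]] := approximation (subspace_span monomials_L2) LG.
have SL : span monomials `<=` @L2 R by case: (subspace_span monomials_L2).
have E : G - g = 0 %[ae mu].
  apply: coefs_ae0; first by l2.
    by move=> n; apply: Hg; apply: sub_span; exists n.
  move=> n; rewrite dotBl ?(H2_neg n HG) ?sub0r //; try l2.
  rewrite (@adherent_orth _ _ g (conjf z ^+ n.+1) SL Lg _ ag) ?oppr0 //; try l2.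
  apply: span_orth; [exact: monomials_L2|l2|].
  move=> _ [k ->]; rewrite /dot conjfX conjfK -exprD addnS.
  exact: cintegral_coordX.
move=> e e0; have [v Vv vle] := ag e e0; exists v => //.
have Lv := SL _ Vv.
rewrite (@nsq_ae _ (G - v) (g - v)) //; try l2.
by apply: aeS E => t /(_ I)/subr0_eq + _; rewrite !fctE => ->.
Qed.

(** Analytic polynomials are dense in [H2], so that the product of two
    functions of [H2] again has no Fourier coefficient of negative index,
    although it need not lie in [L2]. *)
Lemma H2_mul_neg F G n : H2 F -> H2 G -> dot F (conjf (G * z ^+ n.+1)) = 0.
Proof.
move=> HF HG; have LF := H2_L2 HF; have LG := H2_L2 HG.
have -> : dot F (conjf (G * z ^+ n.+1)) = dot G (conjf (F * z ^+ n.+1)).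
  by rewrite /dot !conjfK; congr cintegral; ring.
apply: (@adherent_orth _ (span monomials)) => //.
- by case: (subspace_span monomials_L2).
- by l2.
- exact: H2_adherent.
apply: span_orth; [exact: monomials_L2|l2|].
move=> _ [k ->].
rewrite -(@H2_neg F (k + n) HF) /dot conjfK conjfX conjfK.
by congr cintegral; rewrite -addnS exprD; ring.
Qed.

(** Split off the constant term of [G]: the rest is divisible by the
    coordinate, and [H2_mul_neg] applies. *)
Lemma at0_mul F G : H2 F -> H2 G -> dot F (conjf G) = at0 F * at0 G.
Proof.
move=> HF HG; have LF := H2_L2 HF; have LG := H2_L2 HG.
have E : G = bshift G * z ^+ 1 + cst (at0 G).
  by rewrite expr1 mulrC z_bshift subrK.
have Lb := L2_bshift LG.
rewrite {1}E conjfD conjf_cst dotDr; try l2.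
rewrite H2_mul_neg ?add0r //; last exact: H2_bshift.
by rewrite dot_cstr // conjcK mulrC.
Qed.

Lemma H2_mul F G : H2 F -> H2 G -> ess_bounded F -> H2 (F * G).
Proof.
move=> HF HG bF; apply/H2P; split; first by l2.
move=> n; rewrite -(H2_mul_neg n HF HG) /dot !conjfX !conjfK.
by congr cintegral; ring.
Qed.
Lemma at0M F G : H2 F -> H2 G -> at0 (F * G) = at0 F * at0 G.
Proof. by move=> HF HG; rewrite -at0_mul // /at0 /dot conjf1 conjfK mulr1. Qed.

End Hardy.
#[export] Hint Resolve H2_L2 : l2.

(** * Model spaces and their reproducing functions *)

Section Model.
Variable R : realType.
Notation mu := (circle_measure R).
Notation z := (@coord R).
Notation K := (@model_space R).
Implicit Types f g h F G u : circle_fun R.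

Lemma ae_trans g f h : f = g %[ae mu] -> g = h %[ae mu] -> f = h %[ae mu].
Proof. by apply: aeS2 => t + + _ => /(_ I) -> /(_ I). Qed.

Lemma inner_H2 u : is_inner u -> H2 u. Proof. by case. Qed.
Lemma inner_cancel u : is_inner u -> conjf u * u = 1 %[ae mu].
Proof.
move=> [_]; apply: aeS => t ut _; rewrite /conjf !fctE mulrC.
by rewrite -[LHS]/(u t * (u t)^*%C) -sqr_normc ut expr1n.
Qed.
Lemma inner_bd u : is_inner u -> ess_bounded u.
Proof.
move=> iu; split; first by apply: L2_cmeas; apply: H2_L2; case: iu.
exists 1; case: iu => _; apply: aeS => t; rewrite normc_def => -[ut].
by rewrite -[sqmod u t]sqr_sqrtr ?sqmod_ge0 // /sqmod ut expr1n.
Qed.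

Lemma dot_inner_cancel u f g : is_inner u -> L2 f -> L2 g ->
  dot f (conjf u * (u * g)) = dot f g.
Proof.
move=> iu Lf Lg; have bu := inner_bd iu; apply: dot_aer => //; try l2.
apply: aeS (inner_cancel iu) => t /(_ I) ut _.
by rewrite mulrA; move: ut; rewrite !fctE => ->; rewrite mul1r.
Qed.
Lemma dot_inner u f g : is_inner u -> L2 f -> L2 g ->
  dot (u * f) (u * g) = dot f g.
Proof. by move=> iu Lf Lg; rewrite dot_move dot_inner_cancel. Qed.
Lemma dot_inner_1 u g : is_inner u -> L2 g -> dot u (u * g) = dot 1 g.
Proof.
by move=> iu Lg; rewrite -{1}[u]mulr1 dot_inner //; l2.
Qed.

Lemma K_H2 u f : K u f -> H2 f. Proof. by case. Qed.
Lemma K_L2 u f : K u f -> L2 f. Proof. by move=> /K_H2/H2_L2. Qed.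
#[local] Hint Resolve K_L2 inner_bd : l2.

Lemma K_orth u f h : K u f -> H2 h -> dot f (u * h) = 0.
Proof. by case=> _; exact. Qed.
Lemma K_orth1 u f : K u f -> dot f u = 0.
Proof. by move=> Kf; rewrite -[u]mulr1 K_orth //; exact: H2_1. Qed.

Lemma K_subspace u : is_inner u -> subspace (K u).
Proof.
move=> iu; split.
- by move=> f /K_L2.
- split; first exact: (H2_cst 0).
  by move=> h Hh; rewrite dot0l //; l2.
- move=> a f g Kf Kg; split.
    by apply: H2D; [exact: K_H2 Kf|apply: H2Z; exact: K_H2 Kg].
  move=> h Hh; have Lf := K_L2 Kf; have Lg := K_L2 Kg.
  have Luh : L2 (u * h) by l2.
  by rewrite dotDl ?dotZl ?K_orth ?mulr0 ?addr0 //; l2.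
Qed.
Lemma KD u a f g : is_inner u -> K u f -> K u g -> K u (f + cst a * g).
Proof. by move=> iu Kf Kg; case: (K_subspace iu) => _ _ H; exact: H. Qed.
Lemma K_0 u : is_inner u -> K u 0.
Proof. by move=> iu; case: (K_subspace iu) => _ H _; exact: H. Qed.
Lemma KZ u a f : is_inner u -> K u f -> K u (cst a * f).
Proof.
move=> iu Kf; have -> : cst a * f = 0 + cst a * f by rewrite add0r.
exact: (KD a iu (K_0 iu) Kf).
Qed.
Lemma KB u f g : is_inner u -> K u f -> K u g -> K u (f - g).
Proof. move=> iu Kf Kg; have -> : f - g = f + cst (- 1) * g.
  by rewrite cstN mulN1r.
exact: (KD (- 1) iu Kf Kg). Qed.

(** [K u] is cut out by orthogonality conditions. *)
Lemma K_closed u g : is_inner u -> L2 g -> adherent (K u) g -> K u g.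
Proof.
move=> iu Lg ag; have KL : K u `<=` @L2 R by move=> f /K_L2.
split.
  apply/H2P; split=> // n; apply: (@adherent_orth _ (K u)) => //; first by l2.
  by move=> v Kv; apply: H2_neg; exact: K_H2 Kv.
move=> h Hh; apply: (@adherent_orth _ (K u)) => //; first by l2.
by move=> v Kv; exact: K_orth Kv Hh.
Qed.

Lemma model_projP u f : is_inner u -> L2 f -> K u (model_proj u f) /\
  forall h, K u h -> dot (model_proj u f) h = dot f h.
Proof.
move=> iu Lf; have [g [Lg ag Hg]] := approximation (K_subspace iu) Lf.
have : [set g | K u g /\ forall h, K u h -> dot (f - g) h = 0] g.
  by split => //; exact: K_closed.
move=> /(xgetI 0)[Kp Hp]; split => // h Kh.
apply/esym/eqP; rewrite -subr_eq0 -dotBl ?Hp //.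
- exact: K_L2 Kp.
- exact: K_L2 Kh.
Qed.

(** Elements of [K u] are determined by their scalar products with [K u]. *)
Lemma K_weak u f g : is_inner u -> K u f -> K u g ->
  (forall h, K u h -> dot f h = dot g h) -> f = g %[ae mu].
Proof.
move=> iu Kf Kg H; have Lf := K_L2 Kf; have Lg := K_L2 Kg.
have Kfg := KB iu Kf Kg.
have : nsq (f - g) = 0 by rewrite /nsq dotBl ?H ?subrr //; l2.
move=> /(nsq0_ae (K_L2 Kfg)); apply: aeS => t /(_ I)/subr0_eq + _.
by [].
Qed.

(** [k0t u] is the backward shift of [u] itself, which explains why it lies in
    [K u] although [u] does not. *)
Lemma k0tE u : k0t u = bshift u.
Proof. by rewrite /k0t /bshift disc_ext0 coordE. Qed.
Lemma k0E u : k0 u = 1 - cst ((at0 u)^*)%C * u.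
Proof. by rewrite /k0 disc_ext0. Qed.

Lemma k0_K u : is_inner u -> K u (k0 u).
Proof.
move=> iu; have Hu := inner_H2 iu; have bu := inner_bd iu; rewrite k0E; split.
  by apply: H2B; [exact: H2_1|exact: H2Z].
move=> h Hh; have Lh := H2_L2 Hh; rewrite dotBl ?dotZl ?dot_inner_1 //; try l2.
have -> : dot 1 (u * h) = ((at0 (u * h))^*)%C by rewrite /at0 -dotC //; l2.
have -> : dot 1 h = ((at0 h)^*)%C by rewrite /at0 -dotC //; l2.
by rewrite at0M // rmorphM subrr.
Qed.

(** [k0 u] is the reproducing kernel of [K u] at the origin. *)
Lemma dot_k0r u f : is_inner u -> K u f -> dot f (k0 u) = at0 f.
Proof.
move=> iu Kf; have Lf := K_L2 Kf; have bu := inner_bd iu.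
have Lu : L2 u by l2.
rewrite k0E dotBr //; try l2.
by rewrite (dotZr _ Lf Lu) (K_orth1 Kf) mulr0 subr0.
Qed.
Lemma dot_k0l u f : is_inner u -> K u f -> dot (k0 u) f = ((at0 f)^*)%C.
Proof.
move=> iu Kf; rewrite dotC ?dot_k0r //; last exact: K_L2 (k0_K iu).
exact: K_L2 Kf.
Qed.

(** [K u] is invariant under the backward shift, because multiplication by
    the coordinate leaves [u H2] invariant. *)
Lemma bshift_K u f : is_inner u -> K u f -> K u (bshift f).
Proof.
move=> iu Kf; have Hf := K_H2 Kf; have Lf := K_L2 Kf; have bu := inner_bd iu.
split; first exact: H2_bshift.
move=> h Hh; have Lh := H2_L2 Hh; rewrite /bshift dot_move conjfK dotBl; try l2.
rewrite dot_cstl; last by l2.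
have -> : z * (u * h) = u * (z * h) by ring.
rewrite (K_orth Kf) ?sub0r; last exact: H2_zmul.
have -> : u * (z * h) = z * (u * h) by ring.
rewrite at0_z ?conjc0 ?mulr0 ?oppr0 //.
by apply: H2_mul => //; exact: inner_H2.
Qed.

Lemma bshift_inner_K u : is_inner u -> K u (bshift u).
Proof.
move=> iu; have Hu := inner_H2 iu; have bu := inner_bd iu.
split; first exact: H2_bshift.
move=> h Hh; have Lh := H2_L2 Hh; rewrite /bshift dot_move conjfK dotBl; try l2.
have -> : z * (u * h) = u * (z * h) by ring.
rewrite dot_inner_1 //; last by l2.
have Hz : at0 (z * h) = 0 by exact: at0_z.
have -> : dot 1 (z * h) = ((at0 (z * h))^*)%C by rewrite /at0 -dotC //; l2.
have -> : u * (z * h) = z * (u * h) by ring.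
rewrite dot_cstl ?Hz; last by l2.
rewrite at0_z ?conjc0 ?mulr0 ?subrr //.
exact: H2_mul.
Qed.
Lemma k0t_K u : is_inner u -> K u (k0t u).
Proof. by rewrite k0tE; exact: bshift_inner_K. Qed.

(** [k0t u] represents the functional that measures how far multiplication by
    the coordinate leaves [K u]. *)
Lemma dot_k0t u f : is_inner u -> K u f -> dot f (k0t u) = dot (z * f) u.
Proof.
move=> iu Kf; have bu := inner_bd iu; have Lf := K_L2 Kf.
rewrite k0tE /bshift -dot_move dotBr; try l2.
by rewrite dot_cstr ?at0_z ?mulr0 ?subr0 //; [exact: K_H2 Kf|l2].
Qed.

(** The natural conjugation of [K u]. *)
Definition mconj u f : circle_fun R := u * conjf z * conjf f.

(** Conjugation sends the Fourier coefficients of [f] against [u z ^+ n], which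
    vanish, to those of negative index, and sends orthogonality to [u H2] to
    the absence of negative coefficients in a product. *)
Lemma mconj_K u f : is_inner u -> K u f -> K u (mconj u f).
Proof.
move=> iu Kf; have Hf := K_H2 Kf; have Lf := K_L2 Kf; have bu := inner_bd iu.
have Lm : L2 (mconj u f) by rewrite /mconj; l2.
split.
  apply/H2P; split=> // n; rewrite dotC //; last by l2.
  have -> : dot (conjf z ^+ n.+1) (mconj u f) = dot f (u * z ^+ n).
    rewrite /dot /mconj !conjfM !conjfK conjfX; congr cintegral.
    by rewrite exprS -[RHS]mul1r -coordJcoord; ring.
  rewrite K_orth ?conjc0 //.
  elim: n => [|n IH]; first by rewrite expr0; exact: H2_1.
  by rewrite exprS; exact: H2_zmul.
move=> h Hh; have Lh := H2_L2 Hh.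
have -> : mconj u f = u * (conjf z * conjf f) by rewrite /mconj mulrA.
rewrite dot_inner //; last by l2.
rewrite dotC //; try l2.
have -> : dot h (conjf z * conjf f) = dot h (conjf (f * z ^+ 1)).
  by rewrite expr1 conjfM mulrC.
by rewrite H2_mul_neg ?conjc0.
Qed.

Lemma dot_mconj u f g : is_inner u -> L2 f -> L2 g ->
  dot (mconj u f) (mconj u g) = dot g f.
Proof.
move=> iu Lf Lg; have bu := inner_bd iu.
have E h : mconj u h = u * (conjf z * conjf h) by rewrite /mconj mulrA.
rewrite !E dot_inner //; try l2.
by rewrite dot_move mulrA conjfK coordcoordJ mul1r dotJ.
Qed.

(** A multiple of [u = a b] is in particular a multiple of [b]. *)
Lemma K_sub b a u : is_inner b -> is_inner a -> is_inner u ->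
  u = a * b %[ae mu] -> K b `<=` K u.
Proof.
move=> ib ia iu uab f Kf; have Lf := K_L2 Kf.
have ba := inner_bd ia; have bb := inner_bd ib; have bu := inner_bd iu.
split; first exact: K_H2 Kf.
move=> h Hh; have Lh := H2_L2 Hh.
rewrite (@dot_aer _ _ _ (b * (a * h))) ?(K_orth Kf) //; try l2.
  by apply: H2_mul => //; exact: inner_H2.
by apply: aeS uab => t /(_ I) + _; rewrite !fctE => ->; ring.
Qed.
Lemma mul_K b a u : is_inner b -> is_inner a -> is_inner u ->
  u = a * b %[ae mu] -> forall g, K a g -> K u (b * g).
Proof.
move=> ib ia iu uab g Kg; have Lg := K_L2 Kg.
have ba := inner_bd ia; have bb := inner_bd ib; have bu := inner_bd iu.
split; first by apply: H2_mul => //; [exact: inner_H2|exact: K_H2 Kg].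
move=> h Hh; have Lh := H2_L2 Hh.
rewrite (@dot_aer _ _ _ (b * (a * h))) //; try l2.
  by rewrite dot_inner ?K_orth //; l2.
by apply: aeS uab => t /(_ I) + _; rewrite !fctE => ->; ring.
Qed.

End Model.
#[export] Hint Resolve K_L2 inner_bd : l2.

(** * Bounded functions in model spaces *)

Section Density.
Variable R : realType.
Notation mu := (circle_measure R).
Notation z := (@coord R).
Notation K := (@model_space R).
Implicit Types f g h F G u v : circle_fun R.

Lemma H2_subspace : subspace (@H2 R).
Proof.
split; first by move=> f /H2_L2.
  exact: (H2_cst 0).
by move=> a f g Hf Hg; apply: H2D => //; exact: H2Z.
Qed.
Lemma H2_closed g : L2 g -> adherent (@H2 R) g -> H2 g.
Proof.
move=> Lg ag; apply/H2P; split => // n.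
apply: (@adherent_orth _ (@H2 R)) => //; [by move=> f /H2_L2|by l2|].
by move=> v Hv; exact: H2_neg.
Qed.

(** [H2] is the orthogonal sum of [K u] and [u H2]: the analytic part of
    [u] times a negative power of the coordinate lies in [K u]. *)
Lemma H2_divide u F : is_inner u -> H2 F ->
  (forall g, K u g -> dot F g = 0) -> H2 (conjf u * F).
Proof.
move=> iu HF FK; have bu := inner_bd iu; have LF := H2_L2 HF.
apply/H2P; split; first by l2.
move=> n; rewrite dot_move conjfK; set w := u * _.
have Lw : L2 w by rewrite /w; l2.
have [g [Lg ag Hg]] := approximation H2_subspace Lw.
have HgH := H2_closed Lg ag.
have Kg : K u g.
  split=> // h Hh; have Lh := H2_L2 Hh.
  have Luh : L2 (u * h) by l2.
  have Huh : H2 (u * h) by apply: H2_mul => //; exact: inner_H2.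
  have /eqP := Hg _ Huh; rewrite dotBl // subr_eq0 => /eqP <-.
  have Lzn : L2 (conjf z ^+ n.+1) by l2.
  by rewrite /w dot_inner // dotC // H2_neg ?conjc0.
have -> : dot F w = dot F (w - g) + dot F g.
  by rewrite dotBr // subrK.
have Lwg : L2 (w - g) by l2.
by rewrite (FK g Kg) addr0 dotC // Hg // conjc0.
Qed.

(** The compressed shift in closed form. *)
Definition mshift u f : circle_fun R := z * f - cst (dot (z * f) u) * u.

(** Only the constant term of [h] can pair [z f] with [u h], and the
    correction by [u] removes exactly this contribution. *)
Lemma mshift_K u f : is_inner u -> K u f -> K u (mshift u f).
Proof.
move=> iu Kf; have Hf := K_H2 Kf; have Lf := K_L2 Kf.
have bu := inner_bd iu; have Hu := inner_H2 iu; rewrite /mshift.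
set c := dot _ u; have Lu : L2 u by l2.
split; first by apply: H2B; [exact: H2_zmul|exact: H2Z].
move=> h Hh; have Lh := H2_L2 Hh; have Luh : L2 (u * h) by l2.
have Lzf : L2 (z * f) by l2.
rewrite dotBl ?dotZl //; last by l2.
have Lb := L2_bshift Lh; have Hb := H2_bshift Hh.
have -> : dot (z * f) (u * h) = ((at0 h)^*)%C * c.
  have E : u * h = z * (u * bshift h) + cst (at0 h) * u.
    by rewrite mulrCA z_bshift mulrBr [cst _ * u]mulrC subrK.
  rewrite {1}E dotDr ?dotZr //; try l2.
  rewrite dot_move mulrA coordJcoord mul1r.
  by rewrite (K_orth Kf) ?add0r.
rewrite dot_inner_1 //.
have -> : dot 1 h = ((at0 h)^*)%C by rewrite /at0 -dotC //; l2.
by rewrite mulrC subrr.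
Qed.

Lemma mshift_bd u f : is_inner u -> ess_bounded f -> ess_bounded (mshift u f).
Proof. by move=> iu bf; have bu := inner_bd iu; rewrite /mshift; bd. Qed.

(** The backward shift is the adjoint of the compressed shift. *)
Lemma dot_bshift u f v : is_inner u -> K u f -> K u v ->
  dot (bshift f) v = dot f (mshift u v).
Proof.
move=> iu Kf Kv; have Lf := K_L2 Kf; have Lv := K_L2 Kv; have bu := inner_bd iu.
have Lu : L2 u by l2.
rewrite /bshift dot_move conjfK dotBl ?dot_cstl; try l2.
rewrite at0_z ?conjc0 ?mulr0 ?subr0; last exact: K_H2 Kv.
rewrite /mshift dotBr ?(dotZr _ Lf Lu) ?(K_orth1 Kf) ?mulr0 ?subr0 //; l2.
Qed.

Definition bounded_model u : set (circle_fun R) :=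
  [set f | K u f /\ ess_bounded f].

Lemma bounded_model_subspace u : is_inner u -> subspace (bounded_model u).
Proof.
move=> iu; split.
- by move=> f [/K_L2].
- by split; [exact: K_0|exact: bd0].
- move=> a f g [Kf bf] [Kg bg]; split; [exact: KD|by bd].
Qed.

(** Orthogonality to the bounded functions passes from [f] to its backward
    shift, and orthogonality to [k0 u] kills the constant term; so all Fourier
    coefficients of [f] vanish one after the other. *)
Lemma bounded_model_orth u f : is_inner u -> K u f ->
  (forall v, bounded_model u v -> dot f v = 0) -> f = 0 %[ae mu].
Proof.
move=> iu Kf0 Hf0; apply: coefs_ae0; first exact: K_L2 Kf0.
  move=> n; elim: n f Kf0 Hf0 => [|n IH] f Kf Hf; have f0 : at0 f = 0.
  - rewrite -(dot_k0r iu Kf); apply: Hf; split; first exact: k0_K.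
    by have bu := inner_bd iu; rewrite k0E; bd.
  - by rewrite expr0.
  - rewrite -(dot_k0r iu Kf); apply: Hf; split; first exact: k0_K.
    by have bu := inner_bd iu; rewrite k0E; bd.
  have -> : f = z * bshift f by rewrite z_bshift f0 cst0 subr0.
  rewrite exprS dot_move mulrA coordJcoord mul1r.
  apply: IH; first exact: bshift_K.
  move=> v [Kv bv]; rewrite (dot_bshift iu Kf Kv); apply: Hf.
  by split; [exact: mshift_K|exact: mshift_bd].
by move=> n; apply: H2_neg; exact: K_H2 Kf0.
Qed.

(** Multiplication by an unbounded symbol is only defined on bounded
    functions; these are dense in [K u]. *)
Lemma bounded_model_dense u f : is_inner u -> K u f ->
  adherent (bounded_model u) f.
Proof.
move=> iu Kf; have Lf := K_L2 Kf; have sB := bounded_model_subspace iu.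
have [g [Lg ag Hg]] := approximation sB Lf.
have Kg : K u g.
  apply: K_closed => // e e0; have [v [Kv _] vle] := ag e e0.
  by exists v.
have E : f - g = 0 %[ae mu].
  by apply: (bounded_model_orth iu) => //; exact: KB.
move=> e e0; have [v Vv vle] := ag e e0; exists v => //.
have Lv : L2 v by case: Vv => /K_L2.
rewrite (@nsq_ae _ (f - v) (g - v)) //; try l2.
by apply: aeS E => t /(_ I)/subr0_eq + _; rewrite !fctE => ->.
Qed.

End Density.

(** * Compressed shifts and bounded operators *)

Section Operators.
Variable R : realType.
Notation mu := (circle_measure R).
Notation z := (@coord R).
Notation K := (@model_space R).
Implicit Types f g h F G u v : circle_fun R.

Lemma dot_eq_ael u f g h : K u f -> K u g -> L2 h -> f = g %[ae mu] ->
  dot f h = dot g h.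
Proof. by move=> Kf Kg Lh; apply: dot_ael => //; [exact: K_L2 Kf|exact: K_L2 Kg]. Qed.

Lemma cshift_K u f : is_inner u -> K u f -> K u (cshift u f).
Proof.
move=> iu Kf; have Lf := K_L2 Kf; rewrite /cshift -coordE.
have Lzf : L2 (z * f) by l2.
by case: (model_projP iu Lzf).
Qed.

Lemma cshiftE u f : is_inner u -> K u f -> cshift u f = mshift u f %[ae mu].
Proof.
move=> iu Kf; have Lf := K_L2 Kf; have bu := inner_bd iu.
apply: (K_weak iu (cshift_K iu Kf) (mshift_K iu Kf)) => h Kh.
have Lzf : L2 (z * f) by l2.
have Lh := K_L2 Kh; have Lu : L2 u by l2.
rewrite /cshift -coordE; have [_ ->] := model_projP iu Lzf; last by [].
rewrite /mshift dotBl ?dotZl //; try l2.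
by rewrite (dotC Lh Lu) (K_orth1 Kh) conjc0 mulr0 subr0.
Qed.

(** The backward shift witnesses that the adjoint exists. *)
Lemma cshift_adjP u g : is_inner u -> K u g -> K u (cshift_adj u g) /\
  forall f, K u f -> dot (cshift u f) g = dot f (cshift_adj u g).
Proof.
move=> iu Kg; have Lg := K_L2 Kg.
rewrite /cshift_adj /adjoint; set S := [set h | _].
have : S (bshift g).
  split; first exact: bshift_K.
  move=> f Kf; have Lf := K_L2 Kf.
  have Ks := cshift_K iu Kf; have Km := mshift_K iu Kf.
  have Kb := bshift_K iu Kg.
  rewrite (dot_eq_ael Ks Km Lg (cshiftE iu Kf)).
  rewrite (dotC Lg (K_L2 Km)) -(dot_bshift iu Kg Kf) -dotC //.
  exact: K_L2 Kb.
by move=> /(xgetI 0).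
Qed.

Lemma dot_cshift_adj u g h : is_inner u -> K u g -> K u h ->
  dot (cshift_adj u g) h = dot g (mshift u h).
Proof.
move=> iu Kg Kh; have [Ka Ha] := cshift_adjP iu Kg.
rewrite dotC -?Ha //; [|exact: K_L2 Kh|exact: K_L2 Ka].
rewrite -dotC; [|exact: K_L2 (cshift_K iu Kh)|exact: K_L2 Kg].
apply: dot_aer; [exact: K_L2 Kg|exact: K_L2 (cshift_K iu Kh)| |exact: cshiftE].
exact: K_L2 (mshift_K iu Kh).
Qed.

Lemma nsq_coord f : nsq (z * f) = nsq f.
Proof. by rewrite /nsq dot_move mulrA coordJcoord mul1r. Qed.

(** The estimate is squared because [nsq] and [sqc] are polynomial in the
    scalar products; additivity is stated for differences, the only
    combinations that the density argument forms. *)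
Definition bounded_form (E : set (circle_fun R)) (L : circle_fun R -> R[i]) :=
  (forall f g, E f -> E g -> L (f - g) = L f - L g) /\
  exists2 C : R, 0 <= C & forall f, E f -> sqc (L f) <= C * nsq f.

Lemma sqcM (a b : R[i]) : sqc (a * b) = sqc a * sqc b.
Proof. rewrite /sqc !ReImE; ring. Qed.
Lemma sqcB_le (a b : R[i]) : sqc (a - b) <= 2 * (sqc a + sqc b).
Proof.
rewrite /sqc !ReImE; have := sqr_ge0 (complex.Re a + complex.Re b).
have := sqr_ge0 (complex.Im a + complex.Im b); nra.
Qed.

Lemma bounded_form_dot E k : E `<=` @L2 R -> L2 k -> bounded_form E (fun f => dot f k).
Proof.
move=> EL Lk; split; first by move=> f g /EL Lf /EL Lg; rewrite dotBl.
exists (nsq k); first exact: nsq_ge0.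
by move=> f /EL Lf; rewrite mulrC; exact: cauchy_schwarz.
Qed.
Lemma bounded_formB E L M : bounded_form E L -> bounded_form E M ->
  bounded_form E (fun f => L f - M f).
Proof.
move=> [LB [C C0 HC]] [MB [D D0 HD]]; split.
  by move=> f g Ef Eg; rewrite LB // MB //; ring.
exists (2 * (C + D)); first by rewrite mulr_ge0 // addr_ge0.
move=> f Ef; apply: le_trans (sqcB_le _ _) _.
by rewrite -mulrA ler_wpM2l // mulrDl lerD // ?HC ?HD.
Qed.
Lemma bounded_formZ E L a : bounded_form E L -> bounded_form E (fun f => L f * a).
Proof.
move=> [LB [C C0 HC]]; split; first by move=> f g Ef Eg; rewrite LB // mulrBl.
exists (C * sqc a); first by rewrite mulr_ge0 ?sqc_ge0.
move=> f Ef; rewrite sqcM mulrAC ler_wpM2r ?sqc_ge0 //; exact: HC.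
Qed.

(** Identities between bounded functionals need to be checked on bounded
    functions only. *)
Lemma bounded_form_eq0 u L : is_inner u -> bounded_form (K u) L ->
  (forall f, bounded_model u f -> L f = 0) -> forall f, K u f -> L f = 0.
Proof.
move=> iu [LB [C C0 HC]] L0 f Kf; apply/eqP; rewrite -sqc_eq0 eq_le sqc_ge0 andbT.
apply: (@small_le0 _ _ C) => n.
have [v Vv vle] := bounded_model_dense iu Kf (pow8_gt0 R n).
have Kv : K u v by case: Vv.
have -> : L f = L (f - v) by rewrite LB // (L0 _ Vv) subr0.
apply: le_trans (HC _ (KB iu Kf Kv)) _.
by rewrite ler_wpM2l.
Qed.

Section Bounded.
Variables (theta alpha : circle_fun R) (A : circle_fun R -> circle_fun R).
Hypotheses (it : is_inner theta) (ia : is_inner alpha).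
Hypothesis bA : bounded_operator (K theta) (K alpha) A.

Lemma op_K f : K theta f -> K alpha (A f).
Proof. by case: bA => H _ _; exact: H. Qed.

Lemma op_B f g : K theta f -> K theta g -> A (f - g) = A f - A g %[ae mu].
Proof.
case: bA => _ H _ Kf Kg.
have := H (- 1) g f Kg Kf; rewrite cstN mulN1r addrC => /ae_trans; apply.
by apply: aeW => t _; rewrite mulN1r addrC.
Qed.

Lemma op_bound : exists2 C : R, 0 <= C &
  forall f, K theta f -> nsq (A f) <= C * nsq f.
Proof.
case: bA => _ _ [M HM]; exists (M ^+ 2); first exact: sqr_ge0.
move=> f Kf; rewrite -!normL2_sqr -exprMn.
have h := HM f Kf; have h0 : 0 <= normL2 (A f) by exact: sqrtr_ge0.
by rewrite ler_sqr // nnegrE (le_trans h0).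
Qed.

Lemma op_ae f g : K theta f -> K theta g -> f = g %[ae mu] ->
  A f = A g %[ae mu].
Proof.
move=> Kf Kg fg; have [C C0 HC] := op_bound.
have Kfg := KB it Kf Kg.
have n0 : nsq (f - g) = 0.
  rewrite -(nsq0 R); apply: nsq_ae; [exact: K_L2 Kfg|exact: L2_0|].
  by apply: aeS fg => t /(_ I) ft _; rewrite !fctE ft subrr.
have KA := op_K Kfg.
have nA : nsq (A (f - g)) = 0.
  by apply/eqP; rewrite eq_le nsq_ge0 andbT -(mulr0 C) -n0 HC.
apply: aeS2 (nsq0_ae (K_L2 KA) nA) (op_B Kf Kg) => t /(_ I) a /(_ I) b _.
by apply/eqP; rewrite -subr_eq0 -[X in X == _]b a.
Qed.

Lemma bounded_form_op h : L2 h -> bounded_form (K theta) (fun f => dot (A f) h).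
Proof.
move=> Lh; have [C C0 HC] := op_bound; split.
  move=> f g Kf Kg; have KAf := K_L2 (op_K Kf); have KAg := K_L2 (op_K Kg).
  rewrite -dotBl //; apply: dot_ael => //; first exact: K_L2 (op_K (KB it Kf Kg)).
    by l2.
  exact: op_B.
exists (C * nsq h); first by rewrite mulr_ge0 ?nsq_ge0.
move=> f Kf; apply: le_trans (cauchy_schwarz (K_L2 (op_K Kf)) Lh) _.
by rewrite mulrAC ler_wpM2r ?nsq_ge0 ?HC.
Qed.

Lemma mshiftB u f g : is_inner u -> L2 f -> L2 g ->
  mshift u (f - g) = mshift u f - mshift u g.
Proof.
move=> iu Lf Lg; have bu := inner_bd iu; rewrite /mshift mulrBr dotBl; try l2.
by rewrite cstD cstN; ring.
Qed.

Lemma nsq_mshift u f : is_inner u -> L2 f ->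
  nsq (mshift u f) <= 2 * (1 + nsq u * nsq u) * nsq f.
Proof.
move=> iu Lf; have bu := inner_bd iu; rewrite /mshift.
have Lu : L2 u by l2.
have Lzf : L2 (z * f) by l2.
have LcN : L2 (- (cst (dot (z * f) u) * u)) by l2.
apply: le_trans (nsqD_le Lzf LcN) _.
rewrite nsqN; last by l2.
rewrite nsqZ // nsq_coord.
have := cauchy_schwarz Lzf Lu; rewrite nsq_coord => cs.
have := ler_wpM2r (nsq_ge0 u) cs; lra.
Qed.

Lemma bounded_form_op_shift h : L2 h ->
  bounded_form (K theta) (fun f => dot (A (mshift theta f)) h).
Proof.
move=> Lh; have [LB [C C0 HC]] := bounded_form_op Lh; split.
  move=> f g Kf Kg; rewrite (mshiftB it (K_L2 Kf) (K_L2 Kg)).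
  exact: (LB _ _ (mshift_K it Kf) (mshift_K it Kg)).
exists (C * (2 * (1 + nsq theta * nsq theta))).
  by rewrite !mulr_ge0 // addr_ge0 // mulr_ge0 ?nsq_ge0.
move=> f Kf; apply: le_trans (HC _ (mshift_K it Kf)) _.
by rewrite -mulrA ler_wpM2l // nsq_mshift //; exact: K_L2 Kf.
Qed.

End Bounded.
End Operators.

(** * The shift defect and its symbol *)

Section Main.
Variable R : realType.
Notation mu := (circle_measure R).
Notation z := (@coord R).
Notation K := (@model_space R).
Implicit Types f g h F G u v : circle_fun R.

Lemma mconj_mconj u f : is_inner u -> L2 f -> mconj u (mconj u f) = f %[ae mu].
Proof.
move=> iu Lf; apply: aeS (inner_cancel iu) => t /(_ I) ut _.
have -> : mconj u (mconj u f) = (conjf u * u) * f.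
  by rewrite /mconj !conjfM !conjfK -[RHS]mul1r -coordcoordJ; ring.
by move: ut; rewrite !fctE => ->; rewrite mul1r.
Qed.

(** Both sides equal [\bar z (u - u(0))] since [u \bar u = 1]. *)
Lemma mconj_k0 u : is_inner u -> mconj u (k0 u) = k0t u %[ae mu].
Proof.
move=> iu; apply: aeS (inner_cancel iu) => t /(_ I) ut _.
have -> : mconj u (k0 u) = conjf z * (u - cst (at0 u) * (conjf u * u)).
  by rewrite /mconj k0E conjfB conjf1 conjfM conjf_cst conjcK; ring.
rewrite k0tE /bshift; move: ut; rewrite !fctE => ->; by rewrite mulr1.
Qed.

(** If [\bar z (u - u(0))] vanishes then [u] is constant. *)
Lemma k0t_nsq_neq0 u : is_inner u -> nonconstant u -> nsq (k0t u) != 0.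
Proof.
move=> iu nc; apply/eqP => n0; apply: nc; exists (at0 u).
have := nsq0_ae (K_L2 (k0t_K iu)) n0; rewrite k0tE; apply: aeS => t /(_ I) bt _.
have := congr1 (fun f : circle_fun R => f t) (z_bshift u).
by rewrite !fctE bt mulr0 => /esym/subr0_eq.
Qed.

Section Formula.
Variables (theta alpha psi chi : circle_fun R) (A : circle_fun R -> circle_fun R).
Hypotheses (it : is_inner theta) (ia : is_inner alpha).
Hypothesis dvd : divides alpha theta.
Hypotheses (psiK : K alpha psi) (chiK : K theta chi).
Let beta := inner_quot theta alpha.
Let ib : is_inner beta := dvd.
Let bt := inner_bd it.
Let ba := inner_bd ia.
Let bb := inner_bd ib.
Let Lpsi := K_L2 psiK.
Let Lchi := K_L2 chiK.

Lemma theta_factor : theta = alpha * beta %[ae mu].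
Proof.
apply: aeS (inner_cancel ia) => t /(_ I) at1 _.
have -> : alpha * beta = (conjf alpha * alpha) * theta.
  by rewrite /beta /inner_quot; ring.
by move: at1; rewrite !fctE => ->; rewrite mul1r.
Qed.
Let Q := conjf z * alpha * (conjf psi + chi).
Let e := dot (conjf chi * theta) alpha.

Lemma L2_Q : L2 Q. Proof. by rewrite /Q; l2. Qed.

Section Bounded.
Hypothesis atA : atto theta alpha (psi + conjf chi) A.

Let bA : bounded_operator (K theta) (K alpha) A.
Proof. by case: atA. Qed.

Lemma dot_atto f h : bounded_model theta f -> K alpha h ->
  dot (A f) h = dot ((psi + conjf chi) * f) h.
Proof.
move=> [Kf bf] Kh; have Lf := K_L2 Kf; have Lh := K_L2 Kh.
have Lpf : L2 ((psi + conjf chi) * f) by apply: L2_bdr => //; l2.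
case: atA => _ _ /(_ _ Kf Lpf) Af.
have [Kp <-] := model_projP ia Lpf; last by [].
exact: (dot_eq_ael (op_K bA Kf) Kp Lh Af).
Qed.

(** The defect of [A] from shift invariance, tested against [K alpha]. *)
Let defect f h := dot (A f) h - dot (A (mshift theta f)) (mshift alpha h).

(** Expand [S_theta f = z f - c theta] and [S_alpha h = z h - d alpha]. The
    products of [z f] with [z h] cancel against the first term of the defect;
    the terms with [c] and [d] are the two summands on the right. *)
Lemma defect_bounded f h : bounded_model theta f -> K alpha h ->
  defect f h = dot f (k0t theta) * (dot (mconj theta chi) h - dot (k0t alpha) h * e)
    + dot (k0t alpha) h * dot f Q.
Proof.
move=> Bf Kh; have [Kf bf] := Bf; have Lf := K_L2 Kf; have Lh := K_L2 Kh.
have Bsf : bounded_model theta (mshift theta f).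
  by split; [exact: mshift_K|exact: mshift_bd].
have Ksh := mshift_K ia Kh; have Lsh := K_L2 Ksh.
rewrite /defect (dot_atto Bf Kh) (dot_atto Bsf Ksh).
set phi := psi + conjf chi; have Lphi : L2 phi by rewrite /phi; l2.
rewrite (dot_k0t it Kf); set c := dot (z * f) theta.
have -> : dot (k0t alpha) h = ((dot (z * h) alpha)^*)%C.
  by rewrite -(dot_k0t ia Kh) -dotC //; exact: K_L2 (k0t_K ia).
set d := dot (z * h) alpha.
have Lpt : L2 (phi * theta) by l2.
have Lpzf : L2 (phi * (z * f)) by apply: L2_bdr => //; bd.
have La : L2 alpha by l2.
have Lzh : L2 (z * h) by l2.
have -> : phi * mshift theta f = phi * (z * f) - cst c * (phi * theta).
  by rewrite /mshift -/c; ring.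
rewrite dotBl //; last by l2.
rewrite (dotZl c Lpt Lsh).
have -> : dot (phi * (z * f)) (mshift alpha h) =
    dot (phi * f) h - (d^*)%C * dot f Q.
  rewrite /mshift -/d dotBr //; last by l2.
  rewrite (dotZr d Lpzf La); congr (_ - _ * _).
    have -> : phi * (z * f) = z * (phi * f) by ring.
    by rewrite dot_move mulrA coordJcoord mul1r.
  rewrite /dot /Q /phi !conjfM conjfD !conjfK; congr cintegral; ring.
have Lct : L2 (conjf chi * theta) by l2.
have -> : dot (phi * theta) (mshift alpha h) = dot (mconj theta chi) h - (d^*)%C * e.
  have -> : phi * theta = psi * theta + conjf chi * theta by rewrite /phi mulrDl.
  have Lst : L2 (psi * theta) by l2.
  rewrite dotDl //.
  (* [psi theta = alpha (beta psi)] is orthogonal to [K alpha]. *)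
  have -> : dot (psi * theta) (mshift alpha h) = 0.
    rewrite (dotC Lsh Lst) (@dot_aer _ _ _ (alpha * (beta * psi))) //; try l2.
      rewrite (K_orth Ksh) ?conjc0 //.
      by apply: H2_mul => //; [exact: inner_H2|exact: K_H2 psiK].
    by apply: aeS theta_factor => t /(_ I) + _; rewrite !fctE => ->; ring.
  rewrite add0r /mshift -/d dotBr //; last by l2.
  rewrite (dotZr d Lct La); congr (_ - _ * _).
  have -> : mconj theta chi = conjf z * (conjf chi * theta) by rewrite /mconj; ring.
  by rewrite [RHS]dot_move conjfK.
ring.
Qed.

(** Unlike the operator itself, every term is a bounded functional of [f]
    that makes sense for unbounded [f]. *)
Lemma defect_formula f h : K theta f -> K alpha h ->
  defect f h = dot f (k0t theta) * (dot (mconj theta chi) h - dot (k0t alpha) h * e)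
    + dot (k0t alpha) h * dot f Q.
Proof.
move=> Kf Kh; have Lh := K_L2 Kh.
have KL : K theta `<=` @L2 R by move=> g; exact: K_L2.
have Lsh := K_L2 (mshift_K ia Kh).
have Lk := K_L2 (k0t_K it).
have b1 := bounded_form_op it bA Lh.
have b2 := bounded_form_op_shift it bA Lsh.
have b3 := bounded_formZ (dot (mconj theta chi) h - dot (k0t alpha) h * e)
  (bounded_form_dot KL Lk).
have b4 := bounded_formZ (dot (k0t alpha) h) (bounded_form_dot KL L2_Q).
have b5 := bounded_formB (bounded_formB (bounded_formB b1 b2) b3) b4.
have := bounded_form_eq0 it b5 _ Kf => /(_ _)/eqP.
rewrite -/(defect f h) subr_eq0 subr_eq => H; rewrite (eqP (H _)); first by ring.
move=> g Bg; rewrite -/(defect g h) (defect_bounded Bg Kh); ring.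
Qed.

Lemma dot_defect f h : K theta f -> K alpha h ->
  dot (A f - cshift_adj alpha (A (cshift theta f))) h = defect f h.
Proof.
move=> Kf Kh; have Lh := K_L2 Kh; have Kc := cshift_K it Kf.
have Km := mshift_K it Kf; have KAc := op_K bA Kc; have KAm := op_K bA Km.
have [Ka _] := cshift_adjP ia KAc.
rewrite dotBl //; [|exact: K_L2 (op_K bA Kf)|exact: K_L2 Ka].
rewrite (dot_cshift_adj ia KAc Kh) /defect; congr (_ - _).
have Lsh := K_L2 (mshift_K ia Kh).
exact: (dot_eq_ael KAc KAm Lsh (op_ae it bA Kc Km (cshiftE it Kf))).
Qed.

Lemma defect_K f : K theta f ->
  K alpha (A f - cshift_adj alpha (A (cshift theta f))).
Proof.
move=> Kf; have [Ka _] := cshift_adjP ia (op_K bA (cshift_K it Kf)).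
exact: KB ia (op_K bA Kf) Ka.
Qed.

Hypotheses (anc : nonconstant alpha) (tnc : nonconstant theta).

Lemma dot_neq0 u : nsq u != 0 -> dot u u != 0.
Proof. by move=> n0; rewrite dotff; apply: contra n0 => /eqP[->]. Qed.

(** Evaluating the formula at [h = k0t alpha] isolates the functional of
    [Q]. *)
Lemma rank_one_theta :
  (exists nu0, K alpha nu0 /\ eq_op_on (K theta)
     (fun f => A f - cshift_adj alpha (A (cshift theta f)))
     (tensor nu0 (k0t theta))) <->
  exists l, forall f, K theta f -> dot f Q = l * dot f (k0t theta).
Proof.
have Ka := k0t_K ia; have La := K_L2 Ka.
have na := dot_neq0 (k0t_nsq_neq0 ia anc).
have Lm := K_L2 (mconj_K it chiK).
split=> [[m [Km Hm]]|[l Hl]].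
  have Lm0 := K_L2 Km.
  exists ((dot m (k0t alpha) - dot (mconj theta chi) (k0t alpha)
    + dot (k0t alpha) (k0t alpha) * e) / dot (k0t alpha) (k0t alpha)).
  move=> f Kf; have := defect_formula Kf Ka; rewrite -(dot_defect Kf Ka).
  have KZm : K alpha (tensor m (k0t theta) f) by exact: KZ.
  rewrite (dot_eq_ael (defect_K Kf) KZm La (Hm f Kf)) /tensor (dotZl _ Lm0 La).
  move: (dot f Q) (dot f (k0t theta)) (dot m _) (dot (mconj _ _) _) na.
  move: (dot (k0t alpha) (k0t alpha)) => n q k dm dc n0 E.
  have -> : q = (n * q) / n by field.
  have -> : n * q = k * dm - k * (dc - n * e) by rewrite E; ring.
  by field.
have [Kp Hp] := model_projP ia Lm.
pose m := model_proj alpha (mconj theta chi) + cst (l - e) * k0t alpha.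
have Km : K alpha m by exact: KD.
have Lm' := K_L2 Km.
exists m; split => // f Kf.
have KZm : K alpha (tensor m (k0t theta) f) by exact: KZ.
apply: (K_weak ia (defect_K Kf) KZm) => h Kh; have Lh := K_L2 Kh.
rewrite (dot_defect Kf Kh) (defect_formula Kf Kh) /tensor (dotZl _ Lm' Lh) (Hl f Kf).
rewrite /m dotDl ?(dotZl _ La Lh) ?(Hp h Kh) //; [ring|exact: K_L2 Kp|by l2].
Qed.

(** Evaluating the formula at [f = k0t theta] isolates the functional of
    [C_theta chi]. *)
Lemma rank_one_alpha :
  (exists nu0, K theta nu0 /\ eq_op_on (K theta)
     (fun f => A f - cshift_adj alpha (A (cshift theta f)))
     (tensor (k0t alpha) nu0)) <->
  exists l, forall h, K alpha h ->
    dot (mconj theta chi) h = l * dot (k0t alpha) h.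
Proof.
have Ka := k0t_K ia; have La := K_L2 Ka.
have Kt := k0t_K it; have Lt := K_L2 Kt.
have nt := dot_neq0 (k0t_nsq_neq0 it tnc).
split=> [[m [Km Hm]]|[l Hl]].
  exists (e + (dot (k0t theta) m - dot (k0t theta) Q)
              / dot (k0t theta) (k0t theta)).
  move=> h Kh; have Lh := K_L2 Kh.
  have := defect_formula Kt Kh; rewrite -(dot_defect Kt Kh).
  have KZm : K alpha (tensor (k0t alpha) m (k0t theta)) by exact: KZ.
  rewrite (dot_eq_ael (defect_K Kt) KZm Lh (Hm _ Kt)) /tensor (dotZl _ La Lh).
  move: (dot _ Q) (dot _ m) (dot (k0t alpha) h) (dot (mconj _ _) _) nt.
  move: (dot (k0t theta) (k0t theta)) => n q dm a dc n0 E.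
  have -> : dc = (n * (dc - a * e)) / n + a * e by field.
  have -> : n * (dc - a * e) = dm * a - a * q by rewrite E; ring.
  by field.
have [Kp Hp] := model_projP it L2_Q; have Lp := K_L2 Kp.
pose m := model_proj theta Q + cst ((l - e)^*)%C * k0t theta.
have Km : K theta m by exact: KD.
exists m; split => // f Kf; have Lf := K_L2 Kf.
have KZm : K alpha (tensor (k0t alpha) m f) by exact: KZ.
apply: (K_weak ia (defect_K Kf) KZm) => h Kh; have Lh := K_L2 Kh.
rewrite (dot_defect Kf Kh) (defect_formula Kf Kh) /tensor (dotZl _ La Lh) (Hl h Kh).
have -> : dot f m = dot f Q + (l - e) * dot f (k0t theta).
  rewrite /m dotDr //; last by l2.
  rewrite (dotZr _ Lf Lt) conjcK; congr (_ + _).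
  by rewrite (dotC Lp Lf) (Hp f Kf) -(dotC L2_Q Lf).
ring.
Qed.

End Bounded.

(** Substitute [h = C_alpha g] and simplify the integrands, using that
    [\bar alpha theta] is [beta]. *)
Lemma symbol_alpha :
  (exists l, forall h, K alpha h ->
    dot (mconj theta chi) h = l * dot (k0t alpha) h) <->
  exists c, model_proj alpha (chi * conjf beta) = cst c * k0 alpha %[ae mu].
Proof.
have Lcb : L2 (chi * conjf beta) by apply: L2_bdr => //; bd.
have [Kp Hp] := model_projP ia Lcb; have Lp := K_L2 Kp.
have Kk := k0_K ia; have Lk := K_L2 Kk; have Kkt := k0t_K ia; have Lkt := K_L2 Kkt.
have Kmk := mconj_K ia Kk; have Lmk := K_L2 Kmk.
have E1 g : dot (mconj theta chi) (mconj alpha g) = dot g (chi * conjf beta).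
  rewrite /dot /mconj /beta /inner_quot !conjfM !conjfK; congr cintegral.
  by rewrite -[RHS]mul1r -coordJcoord; ring.
have E2 g : K alpha g -> dot (k0t alpha) (mconj alpha g) = dot g (k0 alpha).
  move=> Kg; have Lg := K_L2 Kg; have Lmg := K_L2 (mconj_K ia Kg).
  by rewrite -(dot_eq_ael Kmk Kkt Lmg (mconj_k0 ia)) dot_mconj.
split=> [[l Hl]|[c Hc]].
  exists (l^*)%C; have KZk := KZ ((l^*)%C) ia Kk.
  apply: (K_weak ia Kp KZk) => g Kg; have Lg := K_L2 Kg.
  rewrite (Hp g Kg) (dotZl _ Lk Lg) (dotC Lg Lcb) -E1 (Hl _ (mconj_K ia Kg)).
  by rewrite (E2 g Kg) rmorphM /= (dotC Lg Lk).
exists (c^*)%C => h Kh; have Lh := K_L2 Kh.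
have Kg := mconj_K ia Kh; have Lg := K_L2 Kg.
have KG := mconj_K ia Kg; have LG := K_L2 KG.
have hE := mconj_mconj ia Lh.
have Lm := K_L2 (mconj_K it chiK).
have KZk := KZ c ia Kk.
rewrite -(dot_aer Lm LG Lh hE) -(dot_aer Lkt LG Lh hE) E1 (E2 _ Kg).
rewrite (dotC Lcb Lg) -(Hp _ Kg) (dot_eq_ael Kp KZk Lg Hc) (dotZl _ Lk Lg).
by rewrite rmorphM /= (dotC Lk Lg).
Qed.

Let W := beta * psi + beta * conjf chi.
Let LW : L2 W. Proof. by rewrite /W; l2. Qed.

(** Substitute [C_theta f] for [f]. *)
Lemma symbol_theta_conj :
  (exists l, forall f, K theta f -> dot f Q = l * dot f (k0t theta)) <->
  exists l, forall f, K theta f -> dot W f = l * ((at0 f)^*)%C.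
Proof.
have Kk := k0_K it; have Lk := K_L2 Kk; have Kkt := k0t_K it; have Lkt := K_L2 Kkt.
have Kmk := mconj_K it Kk; have Lmk := K_L2 Kmk.
have E1 f : dot (mconj theta f) Q = dot W f.
  rewrite /dot /mconj /Q /W /beta /inner_quot !conjfM conjfD !conjfK.
  by congr cintegral; rewrite -[RHS]mul1r -coordJcoord; ring.
have E2 f : K theta f -> dot (mconj theta f) (k0t theta) = ((at0 f)^*)%C.
  move=> Kf; have Lf := K_L2 Kf; have Lmf := K_L2 (mconj_K it Kf).
  rewrite -(dot_aer Lmf Lmk Lkt (mconj_k0 it)) dot_mconj //.
  exact: dot_k0l.
split=> [[l Hl]|[l Hl]]; exists l => f Kf; have Lf := K_L2 Kf.
  by rewrite -E1 (Hl _ (mconj_K it Kf)) (E2 _ Kf).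
have Kg := mconj_K it Kf; have KG := mconj_K it Kg; have LG := K_L2 KG.
have fE := mconj_mconj it Lf.
rewrite -(dot_eq_ael KG Kf L2_Q fE) -(dot_eq_ael KG Kf Lkt fE).
by rewrite E1 (Hl _ Kg) (E2 _ Kg).
Qed.

(** One direction tests with [beta g] for [g] in [K alpha] and then with the
    conjugates of backward shifts in [K beta]; the other divides [chi + \bar s]
    by [beta]. *)
Lemma symbol_theta :
  (exists l, forall f, K theta f -> dot W f = l * ((at0 f)^*)%C) <->
  exists s, psi = cst s * k0 alpha %[ae mu] /\
    model_proj beta chi = cst (- (s^*)%C) * k0 beta %[ae mu].
Proof.
have Ka := k0_K ia; have La := K_L2 Ka; have Kb := k0_K ib; have Lb := K_L2 Kb.
have [Kp Hp] := model_projP ib Lchi.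
have Hbeta := inner_H2 ib; have Hchi := K_H2 chiK.
have Lbe : L2 beta by l2.
have Lbp : L2 (beta * psi) by l2.
have Lbc : L2 (beta * conjf chi) by l2.
split=> [[l Hl]|[s [psiE chiE]]].
  pose s := l * ((at0 beta)^*)%C - ((at0 chi)^*)%C.
  exists s; split.
    have KZk := KZ s ia Ka.
    apply: (K_weak ia psiK KZk) => g Kg; have Lg := K_L2 Kg; have Hg := K_H2 Kg.
    have Kbg := mul_K ib ia it theta_factor Kg.
    have := Hl _ Kbg; rewrite /W dotDl //; last by l2.
    rewrite (at0M Hbeta Hg) (dot_inner ib Lpsi Lg).
    have Lcc : L2 (conjf chi) by l2.
    rewrite (dot_inner ib Lcc Lg) (dotZl _ La Lg) (dot_k0l ia Kg).
    have -> : dot (conjf chi) g = ((at0 chi * at0 g)^*)%C.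
      by rewrite (dotC Lg Lcc) (at0_mul Hg Hchi) mulrC.
    rewrite /s !rmorphM /= => /(canRL (addrK _)) ->; ring.
  have KZk := KZ (- (s^*)%C) ib Kb.
  apply: (K_weak ib Kp KZk) => g Kg; have Lg := K_L2 Kg; have Hg := K_H2 Kg.
  rewrite (Hp g Kg) (dotZl _ Lb Lg) (dot_k0l ib Kg).
  pose g0 := g - cst (at0 g).
  have Lg0 : L2 g0 by rewrite /g0; l2.
  (* Equals [beta] times the conjugate of [g - g(0)]. *)
  pose f := mconj beta (bshift g).
  have fE : f = beta * conjf g0.
    rewrite /f /mconj /bshift -/g0 conjfM conjfK -[RHS]mul1r -coordJcoord; ring.
  have Kf0 : K beta f by exact: mconj_K ib (bshift_K ib Kg).
  have Kf : K theta f by exact: (K_sub ib ia it theta_factor Kf0).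
  have Lf := K_L2 Kf.
  have := Hl _ Kf; rewrite /W dotDl //.
  have -> : dot (beta * psi) f = 0.
    by rewrite (dotC Lf Lbp) (K_orth Kf0 (K_H2 psiK)) conjc0.
  have Lcc : L2 (conjf chi) by l2.
  have Lcg0 : L2 (conjf g0) by l2.
  have -> : dot (beta * conjf chi) f = dot g chi - at0 g * ((at0 chi)^*)%C.
    rewrite fE (dot_inner ib Lcc Lcg0) dotJ /g0 dotBl //; last by l2.
    by rewrite dot_cstl.
  have -> : at0 f = - (((at0 g)^*)%C * at0 beta).
    rewrite /at0 fE -/(at0 g).
    have -> : dot (beta * conjf g0) 1 = dot beta g0.
      by rewrite mulrC dot_move conjfK mulr1 /dot; congr cintegral.
    rewrite /g0 dotBr //; last by l2.
    rewrite (dotC Lg Lbe) (K_orth1 Kg) conjc0 sub0r dot_cstr //.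
  rewrite add0r => /(canRL (subrK _)) E.
  rewrite (dotC Lg Lchi) E /s; move: (at0 g) (at0 beta) (at0 chi) => a b c.
  rewrite !(rmorphM, rmorphD, rmorphN, rmorphB) /= !conjcK; ring.
(* [chi + \bar s] is orthogonal to [K beta], hence divisible by [beta]. *)
pose w := conjf beta * (chi + cst (s^*)%C).
have Lcs : L2 (chi + cst (s^*)%C) by l2.
have Hw : H2 w.
  apply: H2_divide => //; first by apply: H2D => //; exact: H2_cst.
  move=> g Kg; have Lg := K_L2 Kg; have KZk := KZ (- (s^*)%C) ib Kb.
  rewrite dotDl //; last by l2.
  rewrite -(Hp g Kg) (dot_eq_ael Kp KZk Lg chiE) (dotZl _ Lb Lg) (dot_k0l ib Kg).
  by rewrite dot_cstl // mulNr addNr.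
have Lw := H2_L2 Hw.
exists ((at0 w)^*)%C => f Kf; have Lf := K_L2 Kf; have Hf := K_H2 Kf.
have Lcw : L2 (conjf w) by l2.
have Lth : L2 theta by l2.
have -> : ((at0 w)^*)%C * ((at0 f)^*)%C = dot (conjf w) f.
  by rewrite (dotC Lf Lcw) (at0_mul Hf Hw) rmorphM /= mulrC.
rewrite /W.
have Lbk : L2 (beta * (cst s * k0 alpha)) by l2.
rewrite dotDl // (@dot_ael _ _ (beta * (cst s * k0 alpha))) //; last first.
  by apply: aeS psiE => t /(_ I) + _; rewrite !fctE => ->.
have Lbs : L2 (cst s * beta) by l2.
(* [beta psi = s beta - s a0 theta], and [theta] is orthogonal to [K theta]. *)
pose a0 := ((at0 alpha)^*)%C.
have Lts : L2 (cst (s * a0) * theta) by l2.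
have -> : dot (beta * (cst s * k0 alpha)) f = dot (cst s * beta - cst (s * a0) * theta) f.
  apply: dot_ael => //; first by l2.
  apply: aeS theta_factor => t /(_ I) + _; rewrite k0E -/a0.
  have -> : beta * (cst s * (1 - cst a0 * alpha)) =
    cst s * beta - cst (s * a0) * (alpha * beta) by rewrite cstM; ring.
  by rewrite !fctE => ->.
rewrite dotBl // (dotZl _ Lth Lf).
have -> : dot theta f = 0 by rewrite (dotC Lf Lth) (K_orth1 Kf) conjc0.
have Ew : conjf w = cst s * beta + beta * conjf chi.
  have -> : cst s * beta = beta * conjf (cst (s^*)%C) by rewrite conjf_cst conjcK mulrC.
  by rewrite /w conjfM conjfK conjfD; ring.
by rewrite mulr0 subr0 Ew (dotDl Lbs Lbc Lf).
Qed.

End Formula.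
End Main.

Theorem theorem7p2 (R : realType) (alpha theta psi chi : circle_fun R)
    (A : circle_fun R -> circle_fun R)
    (alpha_inner : is_inner alpha) (alpha_nc : nonconstant alpha)
    (theta_inner : is_inner theta) (theta_nc : nonconstant theta)
    (alpha_dvd_theta : divides alpha theta)
    (psiK : model_space alpha psi) (chiK : model_space theta chi)
    (A_atto : atto theta alpha (psi + conjf chi) A) :
  ((exists mu, model_space alpha mu /\
      eq_op_on (model_space theta)
        (fun f => A f - cshift_adj alpha (A (cshift theta f)))
        (tensor mu (k0t theta)))
   <->
   (exists s : R[i], psi = cst s * k0 alpha %[ae (circle_measure R)] /\
      model_proj (inner_quot theta alpha) chi
        = cst (- s^*%C) * k0 (inner_quot theta alpha) %[ae (circle_measure R)]))
  /\
  ((exists nu, model_space theta nu /\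
      eq_op_on (model_space theta)
        (fun f => A f - cshift_adj alpha (A (cshift theta f)))
        (tensor (k0t alpha) nu))
   <->
   (exists c : R[i],
      model_proj alpha (chi * conjf (inner_quot theta alpha))
        = cst c * k0 alpha %[ae (circle_measure R)])).
Proof.
split.
  apply: iff_trans (rank_one_theta theta_inner alpha_inner alpha_dvd_theta
    psiK chiK A_atto alpha_nc) _.
  apply: iff_trans (symbol_theta_conj theta_inner alpha_inner psiK chiK) _.
  exact: symbol_theta theta_inner alpha_inner alpha_dvd_theta psiK chiK.
apply: iff_trans (rank_one_alpha theta_inner alpha_inner alpha_dvd_theta
  psiK chiK A_atto theta_nc) _.
exact: symbol_alpha theta_inner alpha_inner alpha_dvd_theta chiK.
Qed.
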